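(* Let $M\subset\mathbb{C}^{n+1}$, $n\ge 2$, be a real-analytic submanifold given near the origin, in coordinates $(z,w)\in\mathbb{C}^n\times\mathbb{C}$, by $$w=\bar z_1z_2+\bar z_1^2+r(z_1,\bar z_1,z_2,z_3,\ldots,z_n),$$ where $r$ is $O(3)$ (a convergent power series in $z_1,\bar z_1,z_2,\dots,z_n$ with no terms of degree less than $3$; in particular it does not depend on $\bar z_2,\dots,\bar z_n$). Then $M$ is Levi-flat and at the origin $M$ is locally biholomorphically equivalent to the quadric $$w=\bar z_1z_2+\bar z_1^2.$$
   Context: For a real submanifold $M$ of complex Euclidean space with complex structure $J$, $T^c_pM=T_pM\cap J(T_pM)$. $M$ is CR at $p$ if $\dim T^c_qM$ is constant for $q\in M$ near $p$; $M_{CR}$ is the set of such points. A CR submanifold is Levi-flat if its Levi-map vanishes identically (equivalently, $T^cM$ is involutive); a CR singular $M$ is Levi-flat if $M_{CR}$ is. Local biholomorphic equivalence at the origin means by a germ of biholomorphism of $\mathbb{C}^{n+1}$ fixing the origin. *)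

(* Defs.v *)
From HB Require Import structures.
From mathcomp Require Import all_boot all_order all_algebra.
From mathcomp Require Import complex.
From mathcomp Require Import all_classical all_reals all_analysis.

Set Implicit Arguments.
Unset Strict Implicit.
Unset Printing Implicit Defensive.

Import Order.TTheory GRing.Theory Num.Theory.
Import numFieldNormedType.Exports.

Local Open Scope classical_set_scope.
Local Open Scope ring_scope.

(* [R[i]], seen as an abstract [numFieldType]: MathComp-Analysis then provides
   its topology and norm, and the (sup-norm) normed space ['rV[C R]_m] = C^m
   over [C R]. *)
Definition C (R : realType) : numFieldType := R[i].

(* The degree-k homogeneous part, at [x], of the formal power series with
   coefficients [c].  The exponents occurring in a monomial of degree k are at
   most k, whence the finite index type. *)
Definition homog_part (R : realType) (m : nat)
    (c : {ffun 'I_m -> nat} -> C R) (x : 'rV[C R]_m) (k : nat) : C R :=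
  \sum_(a : {ffun 'I_m -> 'I_k.+1} | (\sum_i a i)%N == k)
     c [ffun i => (a i : nat)] * \prod_i x 0 i ^+ a i.

(* The power series [c] converges absolutely at (rho, ..., rho), hence on the
   polydisc of polyradius [rho] centred at 0, and its sum there is [r]. *)
Definition is_pseries_sum (R : realType) (m : nat)
    (c : {ffun 'I_m -> nat} -> C R) (rho : R) (r : 'rV[C R]_m -> C R) : Prop :=
  [/\ 0 < rho,
      cvgn (series (homog_part (fun a => `|c a|) (const_mx (rho%:C)%C))) &
      forall x : 'rV[C R]_m, (forall i, `|x 0 i| < (rho%:C)%C) ->
        series (homog_part c x) @ \oo --> r x].

Definition no_terms_below (R : realType) (m : nat)
    (c : {ffun 'I_m -> nat} -> C R) (d : nat) : Prop :=
  forall a : {ffun 'I_m -> nat}, (\sum_i a i < d)%N -> c a = 0.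

Definition holomorphic_on (R : realType) (m : nat) (U : set 'rV[C R]_m)
    (F : 'rV[C R]_m -> 'rV[C R]_m) : Prop :=
  forall p, U p -> differentiable F p.

Definition biholomorphism (R : realType) (m : nat) (U V : set 'rV[C R]_m)
    (F G : 'rV[C R]_m -> 'rV[C R]_m) : Prop :=
  [/\ holomorphic_on U F, holomorphic_on V G,
      forall p, U p -> V (F p) /\ G (F p) = p &
      forall q, V q -> U (G q) /\ F (G q) = q].

Definition locally_biholo_equiv_at0 (R : realType) (m : nat)
    (M N : set 'rV[C R]_m) : Prop :=
  exists (U V : set 'rV[C R]_m) (F G : 'rV[C R]_m -> 'rV[C R]_m),
    [/\ open_nbhs (0 : 'rV[C R]_m) U, open_nbhs (0 : 'rV[C R]_m) V, biholomorphism U V F G, F 0 = 0 &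
        forall p, U p -> (M p <-> N (F p))].

(* (x_1 + i y_1, ..., x_m + i y_m) |-> (x_1, ..., x_m, y_1, ..., y_m) *)
Definition realify (R : realType) (m : nat) (p : 'rV[C R]_m) : 'rV[R]_(m + m) :=
  row_mx (map_mx (@complex.Re R) p) (map_mx (@complex.Im R) p).

Definition Jmap (R : realType) (m : nat) (v : 'rV[R]_(m + m)) :
    'rV[R]_(m + m) :=
  row_mx (- rsubmx v) (lsubmx v).

(* For an embedded C^1 submanifold it makes no difference whether the curves
   are required to be C^1 or only differentiable at time 0. *)
Definition tangent (R : realType) (k : nat) (M : set 'rV[R]_k) (p : 'rV[R]_k) :
    set 'rV[R]_k :=
  [set v | exists gamma : R -> 'rV[R]_k,
     [/\ gamma 0 = p, \forall t \near (0 : R), M (gamma t) &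
         is_derive (0 : R) (1 : R) gamma v]].

Definition complex_tangent (R : realType) (m : nat)
    (M : set 'rV[R]_(m + m)) (p : 'rV[R]_(m + m)) : set 'rV[R]_(m + m) :=
  tangent M p `&` (@Jmap R m @` tangent M p).

Definition has_dim (R : realType) (k : nat) (T : set 'rV[R]_k) (d : nat) :
    Prop :=
  exists V : {vspace 'rV[R]_k}, (forall v, v \in V <-> T v) /\ \dim V = d.

Definition CR_locus (R : realType) (m : nat) (M : set 'rV[R]_(m + m)) :
    set 'rV[R]_(m + m) :=
  [set p | M p /\ exists d : nat,
     \forall q \near p, M q -> has_dim (complex_tangent M q) d].

Definition C1_near (R : realType) (k : nat) (p : 'rV[R]_k)
    (X : 'rV[R]_k -> 'rV[R]_k) : Prop :=
  \forall q \near p, differentiable X q /\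
    forall v : 'rV[R]_k, {for q, continuous (fun q' => 'd X q' v)}.

Definition lie_bracket (R : realType) (k : nat) (X Y : 'rV[R]_k -> 'rV[R]_k)
    (p : 'rV[R]_k) : 'rV[R]_k :=
  'd Y p (X p) - 'd X p (Y p).

(* T^c M is involutive on the CR locus.  A local section of T^c M near p is
   represented by an ambient vector field, defined near p, whose values at the
   points of M lie in T^c M; the bracket at p of two such fields depends only
   on their restrictions to M. *)
Definition Levi_flat (R : realType) (m : nat) (M : set 'rV[R]_(m + m)) : Prop :=
  forall p, CR_locus M p ->
  forall X Y : 'rV[R]_(m + m) -> 'rV[R]_(m + m),
    C1_near p X -> C1_near p Y ->
    (\forall q \near p, M q ->
       complex_tangent M q (X q) /\ complex_tangent M q (Y q)) ->
    complex_tangent M p (lie_bracket X Y p).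

(* z_j for 1 <= j <= n; the last coordinate is w. *)
Definition zcoord (R : realType) (n : nat) (j : nat) (p : 'rV[C R]_n.+1) : C R :=
  p 0 (inord j.-1).

Definition wcoord (R : realType) (n : nat) (p : 'rV[C R]_n.+1) : C R :=
  p 0 ord_max.

Definition quadratic_part (R : realType) (n : nat) (p : 'rV[C R]_n.+1) : C R :=
  ((zcoord 1 p)^*)%C * zcoord 2 p + ((zcoord 1 p)^*)%C ^+ 2.

Definition quadric (R : realType) (n : nat) : set 'rV[C R]_n.+1 :=
  [set p | wcoord p = quadratic_part p].

(* (z_1, ..., z_n, conj z_1): the n+1 variables of the remainder r, with
   conj z_1 put last. *)
Definition z_conj1 (R : realType) (n : nat) (p : 'rV[C R]_n.+1) :
    'rV[C R]_n.+1 :=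
  \row_i (if i == ord_max then ((zcoord 1 p)^*)%C else p 0 i).

(* Main.v *)
Require Import Defs.
From HB Require Import structures.
From mathcomp Require Import all_boot all_order all_algebra.
From mathcomp Require Import complex ring lra.
From mathcomp Require Import all_classical all_reals all_analysis.

(** Why the theorem is true.  Write f(z, xi) = xi z_2 + xi^2 + r(z, xi), so that M is
    the graph w = f(z, conj z_1) over an open set.

    Equivalence with the quadric.  Since r does not involve conj z_2, ..., conj z_n,
    xi can be treated as one more independent variable and r can be divided, in the
    manner of Weierstrass, by the polynomial xi^2 + s xi - t with free parameters s, t:
      r = Q (xi^2 + s xi - t) + A xi + B,
    where A and B are power series in (z, s, t).  If s and t satisfy
      s = z_2 + A(z, s, t),   t = w - B(z, s, t),                    (E)
    then f - w = (xi^2 + s xi - t) (1 + Q).  Near the origin |Q| < 1, so at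
    xi = conj z_1 the point (z, w) lies on M exactly when
    t = conj z_1 s + conj z_1^2: the map (z_1, z_2, z_3, ..., w) |->
    (z_1, s, z_3, ..., t) carries M to the quadric.  It remains to solve (E)
    holomorphically.  With p = (z, w) and q = (z_1, s, z_3, ..., t), (E) reads
    q = p + displacement p q, and displacement has Lipschitz constant 1/4; a
    contraction argument solves it for q given p and for p given q, and the two
    solutions are inverse to each other (implicit_biholomorphism).  The constant 1/4
    is obtained from a weighted dilation z |-> e z, w |-> e^2 w, which preserves the
    quadric and multiplies the part of degree k of r by e^(k-2): a small factor,
    because r has no terms of degree below 3 (scaled_small).

    The division is carried out monomial by monomial (division).  The estimates on
    the coefficients al_k, be_k of the remainder of xi^k, and the corresponding ones
    for their differences, are of the form X^k and k X^k d; they are stable under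
    products (graded), so that they extend to all monomials, and the series A, B, Q
    are then handled as sums over the coefficients of r in which the monomials have
    been replaced by other functions (hsum, gsum).

    Levi-flatness.  Put kap(z, w) = (z, conj z_1), an R-linear map; then M is
    w = Phi(kap p) with Phi holomorphic, and v is tangent to M at p if and only if
    its last component is dPhi(kap v), taken at kap p.  Comparing v and i v, v is
    complex tangent if and only if, moreover, (d Phi / d xi)(kap p) conj v_1 = 0.
    Let X and Y be fields with values in T^c M along M.  Differentiating the tangency
    relation of Y along a curve of M with velocity X(p), and exchanging X and Y, the
    terms that contain second derivatives of Phi cancel by symmetry, so [X, Y] is
    tangent to M.  As for the second condition, either d Phi / d xi vanishes at kap p,
    and there is nothing to show, or it is nonzero near kap p; then the z_1
    components of X and Y vanish on M near p, and so does that of the bracket. *)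

Set Implicit Arguments.
Unset Strict Implicit.
Unset Printing Implicit Defensive.

Import Order.TTheory GRing.Theory Num.Theory.
Import numFieldNormedType.Exports.

Local Open Scope classical_set_scope.
Local Open Scope ring_scope.

(** * The complex numbers as a normed field: real and imaginary parts, norms *)

Section Interface.
Variable R : realType.
Implicit Types (V : normedModType (C R)) (a b : R) (x y : C R).

Definition rc a : C R := (a%:C)%C.
Definition re x : R := complex.Re x.
Definition im x : R := complex.Im x.
Definition cj x : C R := (x^*)%C.
Definition cplx a b : C R := (a +i* b)%C.

(** The norm of a normed space over C R takes its values in C R itself; [nr] is the
    same number as a real, so that order and linear arithmetic over R apply. *)
Definition nr V (x : V) : R := complex.Re `|x|.

Lemma nrE V (x : V) : `|x| = rc (nr x).
Proof.
rewrite /nr; have := normr_ge0 x; case: (`|x|) => a b.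
by rewrite lecE /= => /andP[/eqP -> _].
Qed.

Lemma nr_norm V (x : V) (b : R) : `|x| = rc b -> nr x = b.
Proof. by rewrite /nr => ->. Qed.

Lemma rc_le a b : (rc a <= rc b) = (a <= b). Proof. exact: lecR. Qed.
Lemma rc_lt a b : (rc a < rc b) = (a < b). Proof. exact: ltcR. Qed.
Lemma rc_inj : injective rc. Proof. by move=> a b []. Qed.
Lemma rcD a b : rc (a + b) = rc a + rc b. Proof. exact: (rmorphD (real_complex R)). Qed.
Lemma rcM a b : rc (a * b) = rc a * rc b. Proof. exact: (rmorphM (real_complex R)). Qed.
Lemma rcX a k : rc (a ^+ k) = rc a ^+ k. Proof. exact: (rmorphXn (real_complex R)). Qed.
Lemma rc0 : rc 0 = 0. Proof. by []. Qed.
Lemma rc1 : rc 1 = 1. Proof. by []. Qed.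

Lemma gt0C x : 0 < x -> exists2 d : R, 0 < d & x = rc d.
Proof. by case: x => a b; rewrite ltcE /= => /andP[/eqP -> a0]; exists a. Qed.

Lemma cjD x y : cj (x + y) = cj x + cj y. Proof. exact: (rmorphD (@conjc R)). Qed.
Lemma cjN x : cj (- x) = - cj x. Proof. exact: (rmorphN (@conjc R)). Qed.
Lemma cjM x y : cj (x * y) = cj x * cj y. Proof. exact: (rmorphM (@conjc R)). Qed.
Lemma cj_rc a : cj (rc a) = rc a. Proof. by rewrite /cj /= oppr0. Qed.

Lemma reD x y : re (x + y) = re x + re y. Proof. by case: x y => [? ?] []. Qed.
Lemma imD x y : im (x + y) = im x + im y. Proof. by case: x y => [? ?] []. Qed.
Lemma reN x : re (- x) = - re x. Proof. by case: x. Qed.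
Lemma imN x : im (- x) = - im x. Proof. by case: x. Qed.
Lemma re0 : re 0 = 0. Proof. by []. Qed.
Lemma im0 : im 0 = 0. Proof. by []. Qed.
Lemma re_cplx a b : re (cplx a b) = a. Proof. by []. Qed.
Lemma im_cplx a b : im (cplx a b) = b. Proof. by []. Qed.
Lemma cplxE x : cplx (re x) (im x) = x. Proof. by case: x. Qed.
Lemma re_rcM a x : re (rc a * x) = a * re x.
Proof. by case: x => u v /=; rewrite mul0r subr0. Qed.
Lemma im_rcM a x : im (rc a * x) = a * im x.
Proof. by case: x => u v /=; rewrite mul0r addr0. Qed.

Lemma nr_rc a : nr (rc a) = `|a|.
Proof. by rewrite /nr normc_def /= expr0n addr0 sqrtr_sqr. Qed.

Lemma nr_conj x : nr (cj x) = nr x.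
Proof. by case: x => a b; rewrite /nr !normc_def /= sqrrN. Qed.

Lemma Re_le_nr x : `|re x| <= nr x.
Proof.
rewrite /nr normc_def /= -sqrtr_sqr ler_sqrt ?addr_ge0 ?sqr_ge0 //.
by rewrite lerDl sqr_ge0.
Qed.

Lemma Im_le_nr x : `|im x| <= nr x.
Proof.
rewrite /nr normc_def /= -sqrtr_sqr ler_sqrt ?addr_ge0 ?sqr_ge0 //.
by rewrite lerDr sqr_ge0.
Qed.

Lemma nr_le_ReIm x : nr x <= `|re x| + `|im x|.
Proof.
rewrite /nr normc_def /= -[leRHS]ger0_norm ?addr_ge0 // -sqrtr_sqr.
rewrite ler_sqrt ?sqr_ge0 // sqrrD !real_normK ?num_real //.
by rewrite lerD2r lerDl mulrn_wge0 // mulr_ge0.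
Qed.

Lemma z_conj1E (n : nat) (p : 'rV[C R]_n.+1) i :
  z_conj1 p 0 i = if i == ord_max then cj (p 0 (inord 0)) else p 0 i.
Proof. by rewrite mxE. Qed.

Lemma quadratic_partE (n : nat) (p : 'rV[C R]_n.+1) :
  quadratic_part p = cj (p 0 (inord 0)) * p 0 (inord 1) + cj (p 0 (inord 0)) ^+ 2.
Proof. by []. Qed.

Lemma is_pseries_sumE m (c : {ffun 'I_m -> nat} -> C R) (rho : R) (r : 'rV[C R]_m -> C R) :
  is_pseries_sum c rho r ->
  [/\ 0 < rho, cvgn (series (homog_part (fun f => `|c f|) (const_mx (rc rho)))) &
     forall x : 'rV[C R]_m, (forall i, nr (x 0 i) < rho) ->
       series (homog_part c x) @ \oo --> r x].
Proof.
move=> [rho0 cc cr]; split; [exact: rho0|exact: cc|move=> x xr].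
apply: (cr x) => i; have := xr i; rewrite -rc_lt -nrE; exact.
Qed.

Lemma normr_lt_rc (x : C R) (rho : R) : (`|x| < (rho%:C)%C) = (nr x < rho).
Proof. by rewrite -rc_lt -nrE. Qed.

Lemma realify_re m (p : 'rV[C R]_m) j : realify p 0 (lshift m j) = re (p 0 j).
Proof. by rewrite /realify row_mxEl mxE. Qed.

Lemma realify_im m (p : 'rV[C R]_m) j : realify p 0 (rshift m j) = im (p 0 j).
Proof. by rewrite /realify row_mxEr mxE. Qed.

Lemma cplx_iM a b : cplx 0 1 * cplx a b = cplx (- b) a.
Proof. by apply/eqP; rewrite eq_complex /= !mul0r !mul1r sub0r add0r !eqxx. Qed.

Lemma cplx_i_sqr : cplx 0 1 * cplx 0 1 = -1.
Proof. by rewrite cplx_iM; apply/eqP; rewrite eq_complex /= oppr0 !eqxx. Qed.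

Lemma cj_i : cj (cplx 0 1) = - cplx 0 1.
Proof. by apply/eqP; rewrite eq_complex /= oppr0 !eqxx. Qed.

End Interface.

(* From here on C R is used as an abstract normed field, with the operations
   and laws listed above. *)
Opaque C rc re im cj cplx nr diff.

(** * Differential calculus in terms of real-valued norms *)

Section RealNorm.
Variable R : realType.
Implicit Types (V W : normedModType (C R)).

Lemma nr_ge0 V (x : V) : 0 <= nr x.
Proof. by have := normr_ge0 x; rewrite nrE -rc0 rc_le. Qed.

Lemma nr_le V (x : V) (e : R) : (nr x <= e) = (`|x| <= rc e).
Proof. by rewrite nrE rc_le. Qed.

Lemma nr_lt V (x : V) (e : R) : (nr x < e) = (`|x| < rc e).
Proof. by rewrite nrE rc_lt. Qed.

Lemma nr0 V : nr (0 : V) = 0.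
Proof. by apply: nr_norm; rewrite normr0 rc0. Qed.

Lemma nrN V (x : V) : nr (- x) = nr x.
Proof. by apply: nr_norm; rewrite normrN nrE. Qed.

Lemma nrBC V (x y : V) : nr (x - y) = nr (y - x).
Proof. by apply: nr_norm; rewrite distrC nrE. Qed.

Lemma nrD V (x y : V) : nr (x + y) <= nr x + nr y.
Proof. by rewrite nr_le rcD -!nrE ler_normD. Qed.

Lemma nrB V (x y : V) : nr (x - y) <= nr x + nr y.
Proof. by rewrite -[nr y]nrN nrD. Qed.

Lemma nrZ V (a : C R) (x : V) : nr (a *: x) = nr (a : C R) * nr x.
Proof. by apply: nr_norm; rewrite rcM -!nrE normrZ. Qed.

Lemma nrM (a b : C R) : nr (a * b : C R) = nr (a : C R) * nr (b : C R).
Proof. exact: (nrZ a b). Qed.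

Lemma nr_sum V (I : Type) (s : seq I) (P : pred I) (f : I -> V) :
  nr (\sum_(i <- s | P i) f i) <= \sum_(i <- s | P i) nr (f i).
Proof.
elim/big_rec2: _ => [|i y x _ le]; first by rewrite nr0.
exact: le_trans (nrD _ _) (lerD _ le).
Qed.

Lemma nr_eq0 V (x : V) : nr x = 0 -> x = 0.
Proof. by move=> x0; apply/normr0_eq0; rewrite nrE x0 rc0. Qed.

Lemma nr1 : nr (1 : C R) = 1.
Proof. by apply: nr_norm; rewrite normr1 rc1. Qed.

Lemma near_nr V (x : V) (P : set V) :
  (\forall y \near x, P y) <->
  exists2 d : R, 0 < d & forall y, nr (y - x) < d -> P y.
Proof.
split=> [/nbhs_normP [e /= /gt0C[d d0 ->] dP]|[d d0 dP]].
  by exists d => // y; rewrite nr_lt distrC => yd; exact: dP.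
apply/nbhs_normP; exists (rc d) => /=; first by rewrite -rc0 rc_lt.
by move=> y /=; rewrite distrC -nr_lt; apply: dP.
Qed.

Lemma open_nr V (A : set V) :
  (forall x, A x -> exists2 d : R, 0 < d & forall y, nr (y - x) < d -> A y) -> open A.
Proof. by move=> AP; rewrite openE => x /AP Ax; apply/near_nr. Qed.

Lemma near_open V (A : set V) (x : V) : open_nbhs x A -> \forall y \near x, A y.
Proof. exact: open_nbhs_nbhs. Qed.

Lemma cvg_nr (T : Type) (F : set_system T) {FF : Filter F} V (f : T -> V) (l : V) :
  f @ F --> l <-> forall e : R, 0 < e -> \forall t \near F, nr (f t - l) <= e.
Proof.
split=> [/cvgrPdist_le fl e e0|fl].
  have e0' : 0 < rc e by rewrite -rc0 rc_lt.
  by apply: filterS (fl _ e0') => t; rewrite nrBC nr_le.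
apply/cvgrPdist_le => e /gt0C[d d0 ->]; apply: filterS (fl _ d0) => t.
by rewrite nrBC nr_le.
Qed.

Lemma nr_coord m (x : 'rV[C R]_m) i : nr (x 0 i : C R) <= nr x.
Proof.
rewrite nr_le -nrE [leRHS]/Num.Def.normr /= mx_normE.
have -> : `|x 0 i| = (`|x 0 i|%:nng)%:num by [].
by rewrite num_le; apply: (@le_bigmax _ _ _ _ (fun j => `|x j.1 j.2|%:nng) (0, i)).
Qed.

Lemma nr_rV_le m (x : 'rV[C R]_m) (e : R) :
  0 <= e -> (forall i, nr (x 0 i : C R) <= e) -> nr x <= e.
Proof.
move=> e0 xe; rewrite nr_le [leLHS]/Num.Def.normr /= mx_normE.
have e0' : 0 <= rc e by rewrite -rc0 rc_le.
rewrite -[leRHS]/((NngNum e0')%:num) num_le; apply/bigmax_leP; split=> //.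
by move=> [j i] _; rewrite -num_le /= ord1 -nr_le.
Qed.

Lemma nr_rV_lt m (x : 'rV[C R]_m) (e : R) :
  0 < e -> (forall i, nr (x 0 i : C R) < e) -> nr x < e.
Proof.
move=> e0 xe.
have [d [d0 de xd]] : exists d : R, [/\ 0 <= d, d < e & forall i, nr (x 0 i : C R) <= d].
  exists (\big[Order.max/0]_i nr (x 0 i : C R)); split.
  - exact: bigmax_ge_id.
  - by apply/bigmax_ltP.
  - by move=> i; apply: le_bigmax.
exact: le_lt_trans (nr_rV_le d0 xd) de.
Qed.

Lemma diff_boundedP V W (f : V -> W) (x : V) : differentiable f x ->
  exists2 K : R, 0 < K & forall h, nr ('d f x h) <= K * nr h.
Proof.
move=> df; have [k k0 kP] := linear_lipschitz (diff_continuous df).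
have [K K0 kE] := gt0C k0; exists K => // h.
by rewrite nr_le rcM -nrE -kE.
Qed.

Lemma diff_epsP V W (f : V -> W) (x : V) : differentiable f x ->
  forall e : R, 0 < e -> \forall y \near x,
    nr (f y - f x - 'd f x (y - x)) <= e * nr (y - x).
Proof.
move=> df e e0; have [_ /eqaddoP fo] := (diff_locallyP _ _).1 df.
have e0' : 0 < rc e by rewrite -rc0 rc_lt.
have /near_nr [d d0 dP] := fo _ e0'; apply/near_nr; exists d => // y yd.
have := dP (y - x); rewrite subr0 => /(_ yd).
rewrite nr_le rcM -nrE.
have -> : (f \o shift x - (cst (f x) + 'd f x)) (y - x) =
          f y - f x - 'd f x (y - x) by rewrite !fctE /= subrK opprD addrA.
by [].
Qed.

(** A bounded linear map approximating the increments of f to first order is the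
    differential.  Continuity of the candidate comes from its bound, so it can be
    produced by pointwise limits or by matrix inversion. *)
Lemma diff_of_eps V W (f : V -> W) (L : {linear V -> W}) (x : V) (K : R) :
  (forall h, nr (L h) <= K * nr h) ->
  (forall e : R, 0 < e -> \forall y \near x,
    nr (f y - f x - L (y - x)) <= e * nr (y - x)) ->
  differentiable f x /\ forall h, 'd f x h = L h.
Proof.
move=> LK fo.
have Lc : continuous L.
  move=> y; apply/cvg_nr => e e0; apply/near_nr.
  exists (e / (`|K| + 1)) => [|z zy]; first by rewrite divr_gt0 // ltr_wpDl.
  rewrite -linearB; apply: le_trans (LK _) _.
  apply: (@le_trans _ _ ((`|K| + 1) * nr (z - y))).
    by rewrite ler_wpM2r ?nr_ge0 // (le_trans (ler_norm _)) // lerDl.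
  by rewrite mulrC -ler_pdivlMr ?ltW // ltr_wpDl.
have fL : f \o shift x = cst (f x) + L +o_ 0 id.
  apply/eqaddoP => _ /gt0C[e e0 ->].
  have /near_nr [d d0 dP] := fo _ e0; apply/near_nr; exists d => // y.
  rewrite subr0 => yd; have := dP (y + x); rewrite addrK => /(_ yd).
  rewrite nr_le rcM -nrE.
  have -> : (f \o shift x - (cst (f x) + L)) y = f (y + x) - f x - L y.
    by rewrite !fctE /= opprD addrA.
  by [].
have dL := diff_unique Lc fL; split; last by move=> h; rewrite dL.
by apply/diff_locallyP; rewrite dL.
Qed.

Lemma is_diff_bounded_linear V W (f : V -> W) (x : V) (K : R) :
  linear f -> (forall h, nr (f h) <= K * nr h) -> is_diff x f f.
Proof.
move=> flin fK.
pose fL := GRing.isLinear.Build _ _ _ _ _ flin.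
pose fm : {linear V -> W} := HB.pack f fL.
have [] := @diff_of_eps V W f fm x K fK.
  move=> e e0; apply: nearW => y.
  by rewrite -[f y]/(fm y) -[f x]/(fm x) -linearB subrr nr0 mulr_ge0 ?nr_ge0 // ltW.
by move=> fd fE; apply: DiffDef => //; apply/funext.
Qed.

Lemma is_diff_bigsum V W (x : V) (I : Type) (s : seq I) (P : pred I)
    (f df : I -> V -> W) :
  (forall i, P i -> is_diff x (f i) (df i)) ->
  is_diff x (fun y => \sum_(i <- s | P i) f i y) (fun h => \sum_(i <- s | P i) df i h).
Proof.
move=> fd; elim: s => [|i s IH].
  have -> : (fun y => \sum_(i <- [::] | P i) f i y) = cst 0.
    by apply/funext => y; rewrite big_nil.
  have -> : (fun h => \sum_(i <- [::] | P i) df i h) = 0.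
    by apply/funext => y; rewrite big_nil.
  exact: is_diff_cst.
have [Pi|Pi] := boolP (P i); last first.
  have E (g : I -> V -> W) : (fun y => \sum_(i <- i :: s | P i) g i y) =
      (fun y => \sum_(i <- s | P i) g i y).
    by apply/funext => y; rewrite big_cons (negbTE Pi).
  by rewrite !E.
have E (g : I -> V -> W) : (fun y => \sum_(i <- i :: s | P i) g i y) =
    g i + (fun y => \sum_(i <- s | P i) g i y).
  by apply/funext => y; rewrite big_cons Pi.
rewrite !E; have := fd _ Pi => fdi; exact: is_diffD.
Qed.

Lemma differentiable_rV V m (f : V -> 'rV[C R]_m) (x : V) :
  (forall i, differentiable (fun y => f y 0 i : C R) x) -> differentiable f x.
Proof.
move=> fd.
have -> : f = (fun y => \sum_i f y 0 i *: delta_mx 0 i).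
  by apply/funext => y; apply: row_sum_delta.
have H i : is_diff x (fun y => f y 0 i *: delta_mx 0 i : 'rV[C R]_m) _ :=
  differentiableP (differentiableZl (delta_mx 0 i : 'rV[C R]_m) (fd i)).
have S := is_diff_bigsum (index_enum 'I_m) (P := xpredT) (fun i _ => H i).
exact: (ex_diff (is_diff_def := S)).
Qed.

(** A local Lipschitz constant bounds the differential: evaluate the increment on a
    short multiple of h and let the error tend to 0. *)
Lemma diff_lip V W (f : V -> W) (x : V) (K : R) : differentiable f x ->
  (\forall y \near x, nr (f y - f x) <= K * nr (y - x)) ->
  forall h, nr ('d f x h) <= K * nr h.
Proof.
move=> df fK h; have [h0|h0] := eqVneq (nr h) 0.
  by rewrite (nr_eq0 h0) linear0 !nr0 mulr0.
have {}h0 : 0 < nr h by rewrite lt_def h0 nr_ge0.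
apply/ler_addgt0Pr => e e0.
have /near_nr [d d0 dP] : \forall y \near x,
    nr (f y - f x) <= K * nr (y - x) /\
    nr (f y - f x - 'd f x (y - x)) <= (e / nr h) * nr (y - x).
  by apply: filterI => //; apply: diff_epsP => //; rewrite divr_gt0.
pose t : R := d / 2 / nr h.
have t0 : 0 < t by rewrite !divr_gt0.
have th : nr (rc t *: h) = d / 2.
  by rewrite nrZ nr_rc (gtr0_norm t0) /t divfK ?gt_eqF.
have /dP : nr ((x + rc t *: h) - x) < d by rewrite addrC addKr th; lra.
rewrite [x + _]addrC addrK th linearZ /=; set u := _ - f x => -[H1 H2].
have := nrB u (u - rc t *: 'd f x h).
rewrite subKr nrZ nr_rc (gtr0_norm t0) => H.
rewrite -(ler_pM2l t0); apply: le_trans H _; apply: le_trans (lerD H1 H2) _.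
by rewrite /t le_eqVlt; apply/orP; left; apply/eqP; field; rewrite gt_eqF.
Qed.

Lemma nr_pair (U W : normedModType (C R)) (x : U * W) :
  nr x = Order.max (nr x.1) (nr x.2).
Proof.
apply: nr_norm; rewrite prod_normE !nrE /Order.max rc_lt.
by case: ifP.
Qed.

Lemma nr_fst (U W : normedModType (C R)) (x : U * W) : nr x.1 <= nr x.
Proof. by rewrite nr_pair le_max lexx. Qed.

Lemma nr_snd (U W : normedModType (C R)) (x : U * W) : nr x.2 <= nr x.
Proof. by rewrite nr_pair le_max lexx orbT. Qed.

Lemma is_diff_fst (U W : normedModType (C R)) (x : U * W) :
  is_diff x (fst : U * W -> U) fst.
Proof.
apply: (@is_diff_bounded_linear _ _ _ x 1) => [a u v //|h].
by rewrite mul1r nr_fst.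
Qed.

Lemma is_diff_snd (U W : normedModType (C R)) (x : U * W) :
  is_diff x (snd : U * W -> W) snd.
Proof.
apply: (@is_diff_bounded_linear _ _ _ x 1) => [a u v //|h].
by rewrite mul1r nr_snd.
Qed.

Lemma is_diff_coord m (x : 'rV[C R]_m) i :
  is_diff x (fun y : 'rV[C R]_m => y 0 i : C R) (fun h => h 0 i).
Proof.
apply: (@is_diff_bounded_linear _ _ _ x 1) => [a u v|h]; first by rewrite !mxE.
by rewrite mul1r nr_coord.
Qed.

End RealNorm.

(** * Series with geometric bounds and their termwise differentiation *)

Section GeometricSeries.
Variable R : realType.
Implicit Types (V W : normedModType (C R)).

Lemma cvg_nr_le V (u : nat -> V) (l : V) (B : R) :
  u @ \oo --> l -> (\forall k \near \oo, nr (u k) <= B) -> nr l <= B.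
Proof.
move=> /cvg_nr ul uB; apply/ler_addgt0Pr => e e0.
have [k [uk Bk]] := filter_ex (filterI (ul _ e0) uB).
rewrite -[l](subKr (u k)); apply: le_trans (nrB _ _) _.
exact: lerD.
Qed.

Lemma geo_partial (K t : R) N m : t < 1 ->
  \sum_(N <= k < N + m) K * t ^+ k = K * t ^+ N / (1 - t) - K * t ^+ (N + m) / (1 - t).
Proof.
move=> t1; have t10 : 1 - t != 0 by rewrite subr_eq0 gt_eqF.
elim: m => [|m IH]; first by rewrite addn0 big_geq // subrr.
rewrite addnS big_nat_recr ?leq_addr //= IH exprS.
by field.
Qed.

Lemma geo_bound V (u : nat -> V) (K t : R) : 0 <= t -> t < 1 ->
  (forall k, nr (u k) <= K * t ^+ k) ->
  forall N M, (N <= M)%N -> nr (series u M - series u N) <= K * t ^+ N / (1 - t).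
Proof.
move=> t0 t1 uK N M NM.
have K0 : 0 <= K by have := uK 0; rewrite expr0 mulr1; apply: le_trans (nr_ge0 _).
rewrite sub_series_geq //; apply: le_trans (nr_sum _ _ _) _.
apply: le_trans (ler_sum _ (fun k _ => uK k)) _.
rewrite -(subnKC NM) geo_partial // gerBl.
apply: divr_ge0; last by rewrite subr_ge0 ltW.
by rewrite mulr_ge0 ?exprn_ge0.
Qed.

(** Geometric bounds give a rate of convergence that depends only on the bounds,
    hence is uniform in the parameters of the series. *)
Lemma geo_tail V (u : nat -> V) (s : V) (K t : R) : 0 <= t -> t < 1 ->
  (forall k, nr (u k) <= K * t ^+ k) -> series u @ \oo --> s ->
  forall N, nr (s - series u N) <= K * t ^+ N / (1 - t).
Proof.
move=> t0 t1 uK us N.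
apply: (@cvg_nr_le V (fun M => series u M - series u N)).
  by apply: cvgB => //; apply: cvg_cst.
by exists N => // M /= NM; apply: geo_bound.
Qed.

Lemma cvg_ReIm (u : nat -> C R) (a b : R) :
  (fun k => re (u k)) @ \oo --> a ->
  (fun k => im (u k)) @ \oo --> b -> u @ \oo --> cplx a b.
Proof.
move=> /cvgrPdist_le ua /cvgrPdist_le ub; apply/cvg_nr => e e0.
have e2 : 0 < e / 2 by rewrite divr_gt0.
apply: filterS (filterI (ua _ e2) (ub _ e2)) => k [uak ubk].
apply: le_trans (nr_le_ReIm _) _.
rewrite !reD !imD !reN !imN re_cplx im_cplx.
by rewrite [leRHS]splitr lerD // distrC.
Qed.

Lemma geo_cvg_real (u : nat -> R) (K t : R) : 0 <= t -> t < 1 ->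
  (forall k, `|u k| <= K * t ^+ k) -> cvgn (series u).
Proof.
move=> t0 t1 uK; apply: normed_cvg.
apply: (@series_le_cvg _ _ (geometric K t)) => //.
- by move=> k; exact: normr_ge0.
- by move=> k; exact: le_trans (normr_ge0 (u k)) (uK k).
- by apply: is_cvg_geometric_series; rewrite ger0_norm.
Qed.

(** The sum as a relation: its uniqueness is used to identify sums, for instance of
    differentials, without first discussing convergence. *)
Definition sums (u : nat -> C R) (l : C R) : Prop := series u @ \oo --> l.

Lemma sums_uniq (u : nat -> C R) (l l' : C R) : sums u l -> sums u l' -> l = l'.
Proof. by move=> ul ul'; apply: (cvg_unique _ ul ul'); exact: norm_hausdorff. Qed.

(** Completeness of C is obtained from that of R, by splitting into real and
    imaginary parts. *)
Lemma geo_cvg (u : nat -> C R) (K t : R) : 0 <= t -> t < 1 ->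
  (forall k, nr (u k : C R) <= K * t ^+ k) -> exists s : C R, sums u s.
Proof.
move=> t0 t1 uK.
have cRe : cvgn (series (fun k => re (u k))).
  apply: (@geo_cvg_real _ K t) => // k; exact: le_trans (Re_le_nr _) (uK k).
have cIm : cvgn (series (fun k => im (u k))).
  apply: (@geo_cvg_real _ K t) => // k; exact: le_trans (Im_le_nr _) (uK k).
exists (cplx (limn (series (fun k => re (u k)))) (limn (series (fun k => im (u k))))).
have ReS k : re (series u k) = series (fun k => re (u k)) k.
  by rewrite /series /=; apply: (big_morph (@re R) (@reD R) (@re0 R)).
have ImS k : im (series u k) = series (fun k => im (u k)) k.
  by rewrite /series /=; apply: (big_morph (@im R) (@imD R) (@im0 R)).
apply: cvg_ReIm.
- by under eq_fun do rewrite ReS.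
- by under eq_fun do rewrite ImS.
Qed.

Lemma cvg_series_lin (K : numFieldType) (u v : nat -> K) (a s s' : K) :
  series u @ \oo --> s -> series v @ \oo --> s' ->
  series (fun k => a * u k + v k) @ \oo --> a * s + s'.
Proof.
move=> us vs.
have -> : series (fun k => a * u k + v k) = (fun n => a * series u n) + series v.
  by apply/funext => n; rewrite [LHS]/series /= big_split /= -mulr_sumr.
by apply: cvgD => //; exact: cvgMl_tmp.
Qed.

Lemma cvg_seriesB (K : numFieldType) (u v : nat -> K) (s s' : K) :
  series u @ \oo --> s -> series v @ \oo --> s' ->
  series (fun k => u k - v k) @ \oo --> s - s'.
Proof.
move=> us vs.
have -> : series (fun k => u k - v k) = series u - series v.
  by rewrite -seriesN -seriesD.
exact: cvgB.
Qed.

Lemma sums_lin (u v : nat -> C R) (a l l' : C R) :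
  sums u l -> sums v l' -> sums (fun k => a * u k + v k) (a * l + l').
Proof. exact: cvg_series_lin. Qed.

Lemma sumsB (u v : nat -> C R) (l l' : C R) :
  sums u l -> sums v l' -> sums (fun k => u k - v k) (l - l').
Proof. exact: cvg_seriesB. Qed.

Lemma sums_tail (u : nat -> C R) (l : C R) (K t : R) : 0 <= t -> t < 1 ->
  (forall k, nr (u k : C R) <= K * t ^+ k) -> sums u l ->
  forall N, nr (l - series u N : C R) <= K * t ^+ N / (1 - t).
Proof. exact: geo_tail. Qed.

(** The Lipschitz constants K t^k of the terms make the tail of the increment of F
    at most a small multiple of the increment of the variable, as well as the tail of
    the series of differentials; the remaining finite sum is differentiable. *)
Lemma series_diff V (f : nat -> V -> C R) (F : V -> C R) (x : V) (K t : R) :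
  0 <= t -> t < 1 -> (forall k, differentiable (f k) x) ->
  (\forall y \near x, sums (fun k => f k y) (F y)) ->
  (\forall y \near x, forall k, nr (f k y - f k x : C R) <= K * t ^+ k * nr (y - x)) ->
  differentiable F x /\
  forall h, sums (fun k => 'd (f k) x h) ('d F x h).
Proof.
move=> t0 t1 fd fF fK.
have dK k h : nr ('d (f k) x h : C R) <= K * t ^+ k * nr h.
  apply: diff_lip => //; apply: filterS fK => y; exact.
have dK' h k : nr ('d (f k) x h : C R) <= (K * nr h) * t ^+ k.
  by rewrite mulrAC.
have dcvg h : exists s : C R, sums (fun k => 'd (f k) x h) s.
  exact: (geo_cvg t0 t1 (dK' h)).
have [L LP] := boolp.choice dcvg.
have Llin : linear L.
  move=> a u v; apply: (sums_uniq (LP (a *: u + v))).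
  have -> : (fun k => 'd (f k) x (a *: u + v) : C R) =
      (fun k => a * 'd (f k) x u + 'd (f k) x v).
    by apply/funext => k; exact: (linearP ('d (f k) x)).
  exact: sums_lin.
pose LL := GRing.isLinear.Build _ _ _ _ _ Llin.
pose Lm : {linear V -> C R} := HB.pack L LL.
have K0 (h : V) : 0 <= K * nr h.
  by have := dK' h 0; rewrite expr0 mulr1; apply: le_trans (nr_ge0 _).
have LK h : nr (Lm h : C R) <= (K / (1 - t)) * nr h.
  have := sums_tail t0 t1 (dK' h) (LP h) 0.
  by rewrite /series /= big_geq // subr0 expr0 mulr1 mulrAC.
suff [Fd FE] : differentiable F x /\ forall h, 'd F x h = Lm h.
  by split; [exact: Fd|move=> h; rewrite [X in sums _ X]FE; exact: LP].
apply: (diff_of_eps LK) => e e0.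
(* e / 3 for the tail of the series, for the tail of the series of
   differentials, and for the finite sum. *)
have [N NP] : exists N, K * t ^+ N / (1 - t) <= e / 3.
  have : (fun N => K * t ^+ N / (1 - t)) @ \oo --> K * 0 / (1 - t).
    by apply: cvgMr_tmp; apply: cvgMl_tmp; apply: cvg_expr; rewrite ger0_norm.
  rewrite mulr0 mul0r => /cvgrPdist_le /(_ (e / 3)) [|N _ NP]; first by rewrite divr_gt0.
  exists N; have := NP N (leqnn N); rewrite /= sub0r normrN; exact: le_trans (ler_norm _).
have tailN y : K * nr (y - x) * t ^+ N / (1 - t) <= e / 3 * nr (y - x).
  have -> : K * nr (y - x) * t ^+ N / (1 - t) = K * t ^+ N / (1 - t) * nr (y - x) by ring.
  by rewrite ler_wpM2r ?nr_ge0.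
have SN : is_diff x (fun y => series (fun k => f k y) N)
                    (fun h => series (fun k => 'd (f k) x h : C R) N).
  by apply: is_diff_bigsum => k _; apply: differentiableP.
have e3 : 0 < e / 3 by rewrite divr_gt0.
have := diff_epsP (ex_diff (is_diff_def := SN)) e3.
have Fx := nbhs_singleton fF.
apply: filterS3 fF fK => y Fy yK yS.
have H1 : nr ((F y - F x) - (series (fun k => f k y) N - series (fun k => f k x) N) : C R)
     <= e / 3 * nr (y - x).
  have cv := sumsB Fy Fx.
  have yK' k : nr (f k y - f k x : C R) <= K * nr (y - x) * t ^+ k by rewrite mulrAC.
  have := sums_tail t0 t1 yK' cv N.
  have -> : series (fun k => f k y - f k x) N =
     series (fun k => f k y) N - series (fun k => f k x) N by rewrite /series /= sumrB.
  by move=> /le_trans; apply; exact: tailN.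
have H2 : nr (L (y - x) - series (fun k => 'd (f k) x (y - x)) N : C R) <= e / 3 * nr (y - x).
  have := sums_tail t0 t1 (dK' (y - x)) (LP (y - x)) N.
  by move=> /le_trans; apply; exact: tailN.
move: yS; rewrite (diff_val (is_diff_def := SN)).
set A := F y - F x in H1 *; set B := _ - series (fun k => f k x) N in H1 *.
set D := series _ N in H2 * => H3.
have -> : A - Lm (y - x) = (A - B) + (B - D) - (L (y - x) - D).
  by rewrite subrKA opprB addrA subrK.
apply: le_trans (nrB _ _) _; apply: le_trans (lerD (nrD _ _) (lexx _)) _.
apply: le_trans (lerD (lerD H1 H3) H2) _.
by rewrite -!mulrDl; apply: ler_wpM2r; [exact: nr_ge0|lra].
Qed.

End GeometricSeries.

(** * Power series with the monomials replaced by other functions *)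

Section GenSeries.
Variables (R : realType) (m : nat).
Implicit Types (c e : {ffun 'I_m -> nat} -> C R).

Definition deg (a : {ffun 'I_m -> nat}) : nat := (\sum_i a i)%N.

(** The part of degree k of the power series c, with each monomial x^a replaced by
    e a.  Taking for e the monomials, their derivatives, or the terms of a division
    by a polynomial, all the series attached to c are treated at once. *)
Definition hsum c e (k : nat) : C R :=
  \sum_(a : {ffun 'I_m -> 'I_k.+1} | (\sum_i a i)%N == k)
     c [ffun i => (a i : nat)] * e [ffun i => (a i : nat)].

(** The l^1 norm of the part of degree k of c. *)
Definition cnorm c (k : nat) : R :=
  \sum_(a : {ffun 'I_m -> 'I_k.+1} | (\sum_i a i)%N == k)
     nr (c [ffun i => (a i : nat)]).

Definition gsum c e : C R := get (sums (hsum c e)).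

Lemma degE k (a : {ffun 'I_m -> 'I_k.+1}) :
  deg [ffun i => (a i : nat)] = (\sum_i a i)%N.
Proof. by apply: eq_bigr => i _; rewrite ffunE. Qed.

Lemma cnorm_ge0 c k : 0 <= cnorm c k.
Proof. by apply: sumr_ge0 => a _; apply: nr_ge0. Qed.

Lemma nr_hsum c e (B X : R) k : (forall a, nr (e a) <= B * X ^+ deg a) ->
  nr (hsum c e k) <= cnorm c k * (B * X ^+ k).
Proof.
move=> eB; apply: le_trans (nr_sum _ _ _) _; rewrite mulr_suml.
apply: ler_sum => a /eqP ak; rewrite nrM ler_wpM2l ?nr_ge0 //.
by apply: le_trans (eB _) _; rewrite degE ak.
Qed.

Lemma hsum_low c e (N k : nat) : no_terms_below c N -> (k < N)%N -> hsum c e k = 0.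
Proof.
move=> cN kN; apply: big1 => a /eqP ak; rewrite cN ?mul0r //.
by rewrite -/(deg _) degE ak.
Qed.

Variables (c : {ffun 'I_m -> nat} -> C R) (K s : R).
Hypotheses (s0 : 0 <= s) (cK : forall k, cnorm c k <= K * s ^+ k).

Lemma nr_hsum_geo e (B X : R) k : 0 <= X -> (forall a, nr (e a) <= B * X ^+ deg a) ->
  nr (hsum c e k) <= K * B * (s * X) ^+ k.
Proof.
move=> X0 eB; apply: le_trans (nr_hsum _ _ eB) _.
have B0 : 0 <= B.
  have := eB [ffun => 0%N].
  have -> : deg [ffun => 0%N] = 0%N by apply: big1 => i _; rewrite ffunE.
  by rewrite expr0 mulr1; apply: le_trans (nr_ge0 _).
have -> : K * B * (s * X) ^+ k = K * s ^+ k * (B * X ^+ k) by rewrite exprMn; ring.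
by rewrite ler_wpM2r // mulr_ge0 ?exprn_ge0.
Qed.

Lemma gsumP e (B X : R) : 0 <= X -> s * X < 1 -> (forall a, nr (e a) <= B * X ^+ deg a) ->
  sums (hsum c e) (gsum c e).
Proof.
move=> X0 sX eB.
have sX0 : 0 <= s * X by rewrite mulr_ge0.
have [S SP] := geo_cvg sX0 sX (fun k => nr_hsum_geo k X0 eB).
by apply: (@getPex _ (sums (hsum c e))); exists S.
Qed.

Lemma gsum_eq e (S : C R) : sums (hsum c e) S -> gsum c e = S.
Proof. by move=> eS; apply: (sums_uniq _ eS); apply: (@getPex _ (sums (hsum c e))); exists S. Qed.

(** The factor (s X)^N is what makes a series with terms of degree at least N small. *)
Lemma gsum_bound e (B X : R) N : 0 <= X -> s * X < 1 -> no_terms_below c N ->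
  (forall a, nr (e a) <= B * X ^+ deg a) ->
  nr (gsum c e) <= K * B * (s * X) ^+ N / (1 - s * X).
Proof.
move=> X0 sX cN eB.
have sX0 : 0 <= s * X by rewrite mulr_ge0.
have := sums_tail sX0 sX (fun k => nr_hsum_geo k X0 eB) (gsumP X0 sX eB) N.
suff -> : series (hsum c e) N = 0 by rewrite subr0.
rewrite /series /= big_nat; apply: big1 => k /andP[_ kN]; exact: hsum_low kN.
Qed.

Lemma hsum_lin e e' (u : C R) k :
  hsum c (fun a => u * e a + e' a) k = u * hsum c e k + hsum c e' k.
Proof.
rewrite mulr_sumr -big_split /=; apply: eq_bigr => a _; rewrite mulrDr.
by congr (_ + _); rewrite mulrCA.
Qed.

Lemma gsum_lin e e' (u S S' : C R) :
  sums (hsum c e) S -> sums (hsum c e') S' ->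
  sums (hsum c (fun a => u * e a + e' a)) (u * S + S').
Proof.
move=> eS eS'.
have -> : hsum c (fun a => u * e a + e' a) = (fun k => u * hsum c e k + hsum c e' k).
  by apply/funext => k; rewrite hsum_lin.
exact: sums_lin.
Qed.

Lemma gsum_sum (I : Type) (r : seq I) (u : I -> C R)
    (e : I -> {ffun 'I_m -> nat} -> C R) (S : I -> C R) :
  (forall i, sums (hsum c (e i)) (S i)) ->
  sums (hsum c (fun a => \sum_(i <- r) u i * e i a)) (\sum_(i <- r) u i * S i).
Proof.
move=> eS; elim: r => [|i r IH].
  have -> : hsum c (fun a => \sum_(i <- [::]) u i * e i a) = (fun=> 0).
    apply/funext => k; apply: big1 => a _.
    by rewrite big_nil mulr0.
  rewrite big_nil /sums.
  have -> : series (fun=> 0 : C R) = cst 0 by apply/funext => N; apply: big1.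
  exact: cvg_cst.
have -> : (fun a => \sum_(i <- i :: r) u i * e i a) =
   (fun a => u i * e i a + \sum_(i <- r) u i * e i a).
  by apply/funext => a; rewrite big_cons.
rewrite big_cons /=; exact: (gsum_lin (eS i) IH).
Qed.

(** Termwise differentiation in the form used here: the Lipschitz constants of e a
    may grow like X^deg a, with X below the radius of convergence 1/s. *)
Lemma gsum_diff (V : normedModType (C R)) (e : {ffun 'I_m -> nat} -> V -> C R)
    (x : V) (B X : R) :
  0 <= X -> s * X < 1 -> (forall a, differentiable (e a) x) ->
  (\forall y \near x, forall a, nr (e a y) <= B * X ^+ deg a) ->
  (\forall y \near x, forall a, nr (e a y - e a x) <= B * nr (y - x) * X ^+ deg a) ->
  differentiable (fun y => gsum c (fun a => e a y)) x /\
  forall h, sums (hsum c (fun a => 'd (e a) x h))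
    ('d (fun y => gsum c (fun a => e a y)) x h).
Proof.
move=> X0 sX ed eB eL.
have sX0 : 0 <= s * X by rewrite mulr_ge0.
pose f k (y : V) := hsum c (fun a => e a y) k.
pose df k (h : V) := hsum c (fun a => 'd (e a) x h) k.
have fd k : is_diff x (f k) (df k).
  apply: is_diff_bigsum => a _.
  have := differentiableP (ed [ffun i => (a i : nat)]) => ea.
  exact: (is_diffZ (c [ffun i => (a i : nat)]) ea).
have fd' k : differentiable (f k) x := ex_diff (is_diff_def := fd k).
have [Fd FE] : differentiable (fun y => gsum c (fun a => e a y)) x /\
   forall h, sums (fun k => 'd (f k) x h) ('d (fun y => gsum c (fun a => e a y)) x h).
  apply: (series_diff (K := K * B) (t := s * X)) => //.
  - by apply: filterS eB => y eB; apply: gsumP sX eB.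
  - apply: filterS eL => y eL k.
  have -> : f k y - f k x = hsum c (fun a => e a y - e a x) k.
    by rewrite /f -sumrB; apply: eq_bigr => a _; rewrite mulrBr.
  apply: le_trans (nr_hsum_geo k X0 eL) _.
  by rewrite le_eqVlt; apply/orP; left; apply/eqP; ring.
split=> // h; have -> : hsum c (fun a => 'd (e a) x h) = (fun k => 'd (f k) x h).
  apply/funext => k.
  exact: (esym (congr1 (fun g : V -> C R => g h) (diff_val (is_diff_def := fd k)))).
exact: FE.
Qed.

End GenSeries.

(** * Solving a small perturbation of the identity in both directions *)

Section Implicit.
Variables (R : realType) (m : nat).
Local Notation V := 'rV[C R]_m.

Lemma le0_geo (x B t : R) : 0 <= t -> t < 1 -> (forall k, x <= B * t ^+ k) -> x <= 0.
Proof.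
move=> t0 t1 xB.
have /cvgrPdist_le Bt : (fun k => B * t ^+ k) @ \oo --> B * 0.
  by apply: cvgMl_tmp; apply: cvg_expr; rewrite ger0_norm.
apply/ler_addgt0Pr => e /Bt [k _ /(_ k (leqnn k))]; rewrite mulr0 sub0r normrN add0r => Hk.
exact: le_trans (xB k) (le_trans (ler_norm _) Hk).
Qed.

(** Coordinatewise, the telescoping series of differences converges; this gives
    completeness of the space of row vectors for the sequences that occur in a
    contraction argument. *)
Lemma geo_seq_cvg (y : nat -> V) (t : R) : 0 <= t -> t < 1 ->
  (forall k, nr (y k.+1 - y k) <= t ^+ k) ->
  exists l, forall k, nr (l - y k) <= t ^+ k / (1 - t).
Proof.
move=> t0 t1 yt.
have yi i k : nr (y k.+1 0 i - y k 0 i) <= 1 * t ^+ k.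
  by rewrite mul1r; apply: le_trans (yt k); have := nr_coord (y k.+1 - y k) i; rewrite !mxE.
have /boolp.choice [S SP] i : exists s, sums (fun k => y k.+1 0 i - y k 0 i) s.
  exact: (geo_cvg t0 t1 (yi i)).
exists (\row_i (S i + y 0%N 0 i)) => k.
apply: nr_rV_le => [|i].
  by apply: divr_ge0; rewrite ?exprn_ge0 // subr_ge0 ltW.
have := sums_tail t0 t1 (yi i) (SP i) k.
by rewrite mul1r !mxE seriesEnat /= telescope_sumr // opprB addrA.
Qed.

Section Solve.
Variable phi : V -> V -> V.
Hypothesis phi_lip : forall p q p' q', nr p < 1 -> nr q < 1 -> nr p' < 1 -> nr q' < 1 ->
  nr (phi p q - phi p' q') <= 4^-1 * (nr (p - p') + nr (q - q')).
Hypothesis phi0 : phi 0 0 = 0.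

Let lt01 : nr (0 : V) < 1. Proof. by rewrite nr0. Qed.

Lemma phi_bound p q : nr p < 1 -> nr q < 1 -> nr (phi p q) <= 4^-1 * (nr p + nr q).
Proof.
by move=> p1 q1; have := phi_lip p1 q1 lt01 lt01; rewrite phi0 !subr0.
Qed.

(** Contraction principle for q |-> p + phi p q.  Since |p| < 1/2 and phi is bounded
    by (|p| + |q|) / 4, the iterates stay in the ball of radius 7/8. *)
Lemma solve_ex p : nr p < 2^-1 -> exists q, nr q < 1 /\ q = p + phi p q.
Proof.
move=> p1.
have {}p1' : nr p < 1 by lra.
pose y := fun k => iter k (fun q => p + phi p q) 0.
have y1 k : nr (y k) <= 7 / 8.
  elim: k => [|k IH]; first by rewrite /y /= nr0; lra.
  have yk1 : nr (y k) < 1 by lra.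
  have := phi_bound p1' yk1; have := nrD p (phi p (y k)); rewrite -[p + _]/(y k.+1).
  lra.
have y1' k : nr (y k) < 1 by have := y1 k; lra.
have yd k : nr (y k.+1 - y k) <= 4^-1 ^+ k.
  elim: k => [|k IH]; first by rewrite /= subr0 expr0; have := y1 1%N; rewrite /y /=; lra.
  have -> : y k.+2 - y k.+1 = phi p (y k.+1) - phi p (y k).
    by rewrite /y !iterS opprD addrACA subrr add0r.
  have := phi_lip p1' (y1' k.+1) p1' (y1' k); rewrite subrr nr0 add0r exprS.
  move/le_trans; apply; by rewrite ler_wpM2l // invr_ge0.
have t0 : 0 <= 4^-1 :> R by rewrite invr_ge0.
have t1 : 4^-1 < 1 :> R by lra.
have [l] := geo_seq_cvg t0 t1 yd.
have -> : (1 - 4^-1)^-1 = 4 / 3 :> R by field.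
move=> lP.
have l1 : nr l <= 7 / 8.
  rewrite -subr_le0; apply: (le0_geo (t := 4^-1) (B := 4 / 3)) => // k.
  have := lP k; have := nrD (l - y k) (y k); rewrite subrK; have := y1 k.
  by move: (4^-1 ^+ k) => T; lra.
have l1' : nr l < 1 by lra.
exists l; split=> //; apply/eqP; rewrite -subr_eq0; apply/eqP/nr_eq0/eqP.
rewrite eq_le nr_ge0 andbT.
apply: (le0_geo (t := 4^-1) (B := 8 / 3)) => // k.
have -> : l - (p + phi p l) = (l - y k.+1) + (phi p (y k) - phi p l).
  by rewrite /y iterS -/(y k) !opprD !addrA subrK.
have := nrD (l - y k.+1) (phi p (y k) - phi p l).
have := phi_lip p1' (y1' k) p1' l1'; rewrite subrr nr0 add0r [nr (y k - l)]nrBC.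
have := lP k; have := lP k.+1; rewrite exprS.
have := exprn_ge0 k t0; move: (4^-1 ^+ k) => T; lra.
Qed.

Definition solve p : V := get (fun q => nr q < 1 /\ q = p + phi p q).

Lemma solveP p : nr p < 2^-1 -> nr (solve p) < 1 /\ solve p = p + phi p (solve p).
Proof.
move=> /solve_ex ex.
exact: (@getPex _ (fun q => nr q < 1 /\ q = p + phi p q) ex).
Qed.

(** Absorb the term |q - q'| / 4 coming from phi into the left-hand side; this
    yields the uniqueness of the solution and its continuity at once. *)
Lemma fixpoint_lip p q p' q' : nr p < 1 -> nr q < 1 -> nr p' < 1 -> nr q' < 1 ->
  q = p + phi p q -> q' = p' + phi p' q' -> nr (q - q') <= 2 * nr (p - p').
Proof.
move=> p1 q1 p1' q1' qE qE'.
have := phi_lip p1 q1 p1' q1'; have := nrD (p - p') (phi p q - phi p' q').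
rewrite addrACA -opprD -qE -qE'; have := nr_ge0 (p - p'); lra.
Qed.

Lemma solve_uniq p q : nr p < 2^-1 -> nr q < 1 -> q = p + phi p q -> q = solve p.
Proof.
move=> p1 q1 qE; have [s1 sE] := solveP p1; have p1' : nr p < 1 by lra.
have := fixpoint_lip p1' q1 p1' s1 qE sE; rewrite subrr nr0 mulr0 => H.
apply/eqP; rewrite -subr_eq0; apply/eqP/nr_eq0/eqP.
by rewrite eq_le nr_ge0 andbT.
Qed.

Lemma solve0 : solve 0 = 0.
Proof. by apply/esym/solve_uniq; rewrite ?nr0 ?phi0 ?addr0 // invr_gt0. Qed.

Lemma solve_lip p p' : nr p < 2^-1 -> nr p' < 2^-1 ->
  nr (solve p - solve p') <= 2 * nr (p - p').
Proof.
move=> p1 p1'; have [s1 sE] := solveP p1; have [s1' sE'] := solveP p1'.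
by apply: fixpoint_lip => //; lra.
Qed.

Hypothesis phi_diff : forall p q, nr p < 1 -> nr q < 1 ->
  differentiable (fun z : V * V => phi z.1 z.2) (p, q).

Lemma solve_near (p : V) : nr p < 2^-1 -> \forall p' \near p, nr p' < 2^-1.
Proof.
move=> p1; apply/near_nr; exists (2^-1 - nr p); first by rewrite subr_gt0.
by move=> y; have := nrD (y - p) p; rewrite subrK; lra.
Qed.

(** The candidate differential is h |-> (id - D_q)^-1 (h + D_p h), with D_p and D_q
    the partial differentials of phi.  As D_q has norm at most 1/2, id - D_q is
    injective with a bounded inverse. *)
Lemma solve_diff p : nr p < 2^-1 -> differentiable solve p.
Proof.
move=> p1; have p1' : nr p < 1 by lra.
have [] := solveP p1; move: (erefl (solve p)); set q := {2 3 4}(solve p) => pq q1 qE.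
have Pd := phi_diff p1' q1.
set Phi := fun z : V * V => phi z.1 z.2 in Pd.
(* The sum of two component norms is at most twice the norm of the pair,
   whence 2 * 1/4. *)
have Dle h : nr ('d Phi (p, q) h) <= 2^-1 * nr h.
  apply: diff_lip => //; apply/near_nr.
  exists (Order.min (1 - nr p) (1 - nr q)); first by rewrite lt_min !subr_gt0 p1'.
  move=> [p' q']; rewrite lt_min => /andP[/= H1 H2].
  have := nr_fst ((p', q') - (p, q)); have := nr_snd ((p', q') - (p, q)) => /= H3 H4.
  have := nrD (p' - p) p; have := nrD (q' - q) q; rewrite !subrK => H5 H6.
  have P1 : nr p' < 1 by lra.
  have Q1 : nr q' < 1 by lra.
  by have := phi_lip P1 Q1 p1' q1; rewrite /Phi /=; lra.
(* M = id - D_q; its inverse N is obtained through its matrix, since M is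
   injective on a space of finite dimension. *)
pose M (k : V) : V := k - 'd Phi (p, q) (0, k).
have Mlin : linear M.
  move=> a u v; rewrite /M.
  have -> : (0, a *: u + v) = a *: (0, u) + (0, v) :> V * V.
    by congr (_, _) => /=; rewrite scaler0 addr0.
  by rewrite linearP scalerBr opprD addrACA.
pose ML := GRing.isLinear.Build _ _ _ _ _ Mlin.
pose Mm : {linear V -> V} := HB.pack M ML.
have nr0k (k : V) : nr ((0, k) : V * V) = nr k.
  by rewrite nr_pair /= nr0 max_r // nr_ge0.
have nrk0 (k : V) : nr ((k, 0) : V * V) = nr k.
  by rewrite nr_pair /= nr0 max_l // nr_ge0.
have Mge k : nr k <= 2 * nr (M k).
  have := Dle (0, k); rewrite nr0k; have := nrD (M k) ('d Phi (p, q) (0, k)).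
  rewrite /M subrK; lra.
have Mu : lin1_mx Mm \in unitmx.
  rewrite -row_free_unit; apply: inj_row_free => v; rewrite mul_rV_lin1 /= => Mv.
  by apply/nr_eq0/eqP; rewrite eq_le nr_ge0 andbT; have := Mge v; rewrite Mv nr0 mulr0.
pose N (h : V) : V := h *m invmx (lin1_mx Mm).
have NM k : N (M k) = k.
  by rewrite /N -[M k]/(Mm k) -mul_rV_lin1 mulmxK.
have MN h : M (N h) = h by rewrite -[LHS]/(Mm _) -mul_rV_lin1 /N mulmxKV.
have Nle h : nr (N h) <= 2 * nr h by have := Mge (N h); rewrite MN.
have NB h h' : N (h - h') = N h - N h' by rewrite /N mulmxBl.
pose L (h : V) : V := N (h + 'd Phi (p, q) (h, 0)).
have Llin : linear L.
  move=> a u v; rewrite /L.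
  have -> : (a *: u + v, 0) = a *: (u, 0) + (v, 0) :> V * V.
    by congr (_, _) => /=; rewrite scaler0 addr0.
  by rewrite linearP /N addrACA -scalerDr mulmxDl scalemxAl.
pose LL := GRing.isLinear.Build _ _ _ _ _ Llin.
pose Lm : {linear V -> V} := HB.pack L LL.
have Lle h : nr (Lm h) <= 3 * nr h.
  rewrite -[Lm h]/(L h) /L.
  have := Dle (h, 0); rewrite nrk0; have := nrD h ('d Phi (p, q) (h, 0)).
  have := Nle (h + 'd Phi (p, q) (h, 0)); lra.
suff [] : differentiable solve p /\ forall h, 'd solve p h = Lm h by [].
apply: (diff_of_eps Lle) => e e0.
have e4 : 0 < e / 4 by rewrite divr_gt0.
have /near_nr [d d0 dP] := diff_epsP Pd e4.
have d20 : 0 < d / 2 by rewrite divr_gt0.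
have near_d : \forall p' \near p, nr (p' - p) < d / 2 by apply/near_nr; exists (d / 2).
apply: filterS2 (solve_near p1) near_d => p' pp1 pd.
have [s1 sE] := solveP pp1.
have ql := solve_lip pp1 p1.
rewrite pq in ql *.
have zd : nr ((p', solve p') - (p, q)) <= 2 * nr (p' - p).
  by rewrite nr_pair /= ge_max ql andbT; have := nr_ge0 (p' - p); lra.
have := dP (p', solve p'); move=> /(_ (le_lt_trans zd _)).
have -> : 2 * nr (p' - p) < d by lra.
move=> /(_ isT) H.
pose err := Phi (p', solve p') - Phi (p, q) - 'd Phi (p, q) ((p', solve p') - (p, q)).
(* Applying M to both sides leaves the definition of the error err of the
   first order expansion of Phi. *)
have -> : solve p' - q - Lm (p' - p) = N err.
  rewrite -[LHS](NM) -[Lm _]/(L _).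
  congr N; rewrite /M /L /err.
  have MB u v : M (u - v) = M u - M v by exact: (linearB Mm).
  rewrite -/(M _) MB MN /M.
  have -> : (p', solve p') - (p, q) = (p' - p, 0) + (0, solve p' - q) :> V * V.
    by congr (_, _) => /=; rewrite ?addr0 ?add0r.
  have E : solve p' - q = (p' - p) + (Phi (p', solve p') - Phi (p, q)).
    by rewrite {1}sE {1}qE opprD addrACA.
  have alg (P F A B : V) : P + F - B - (P + A) = F - (A + B).
    apply/eqP; rewrite subr_eq opprD [P + A]addrC !addrA -[F - A - B + A]addrAC.
    by rewrite subrK [P + F]addrC addrAC.
  by rewrite [in RHS]linearD [X in X - _ - _]E; exact: alg.
apply: le_trans (Nle _) _.
have := nr_ge0 (p' - p); move: H; rewrite -/err; nra.
Qed.

End Solve.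

Lemma open_nbhs_solve (phi : V -> V -> V) :
  (forall p q p' q', nr p < 1 -> nr q < 1 -> nr p' < 1 -> nr q' < 1 ->
    nr (phi p q - phi p' q') <= 4^-1 * (nr (p - p') + nr (q - q'))) ->
  phi 0 0 = 0 ->
  open_nbhs (0 : V) [set p | nr p < 2^-1 /\ nr (solve phi p) < 2^-1].
Proof.
move=> philip phi0; split; last first.
  by rewrite /= (solve0 philip phi0) nr0 invr_gt0.
apply: open_nr => p [/= p1 sp1].
pose d := Order.min (2^-1 - nr p) ((2^-1 - nr (solve phi p)) / 2).
have d0 : 0 < d by rewrite lt_min subr_gt0 p1 divr_gt0 // subr_gt0.
exists d => // y; rewrite lt_min => /andP[H1 H2].
have y1 : nr y < 2^-1 by have := nrD (y - p) p; rewrite subrK; lra.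
split=> //; have := solve_lip philip phi0 y1 p1.
by have := nrD (solve phi y - solve phi p) (solve phi p); rewrite subrK; lra.
Qed.

(** The relation q = p + phi p q can be read both as an equation for q and as an
    equation p = q - phi p q for p, of the same kind.  Their solutions are inverse to
    each other by uniqueness. *)
Lemma implicit_biholomorphism (phi : V -> V -> V) :
  (forall p q p' q', nr p < 1 -> nr q < 1 -> nr p' < 1 -> nr q' < 1 ->
    nr (phi p q - phi p' q') <= 4^-1 * (nr (p - p') + nr (q - q'))) ->
  phi 0 0 = 0 ->
  (forall p q, nr p < 1 -> nr q < 1 ->
    differentiable (fun z : V * V => phi z.1 z.2) (p, q)) ->
  exists (U W : set V) (F G : V -> V),
    [/\ open_nbhs (0 : V) U, open_nbhs (0 : V) W, biholomorphism U W F G, F 0 = 0 &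
        forall p, U p -> [/\ nr p < 1, nr (F p) < 1 & F p = p + phi p (F p)]].
Proof.
move=> philip phi0 phid.
(* p = q + psi q p is the same equation, solved for p. *)
pose psi q p := - phi p q.
have psilip p q p' q' : nr p < 1 -> nr q < 1 -> nr p' < 1 -> nr q' < 1 ->
    nr (psi p q - psi p' q') <= 4^-1 * (nr (p - p') + nr (q - q')).
  by move=> *; rewrite /psi -opprD nrN [nr (p - _) + _]addrC; apply: philip.
have psi0 : psi 0 0 = 0 by rewrite /psi phi0 oppr0.
have psid p q : nr p < 1 -> nr q < 1 ->
    differentiable (fun z : V * V => psi z.1 z.2) (p, q).
  move=> p1 q1; have phiqp := phid _ _ q1 p1.
  have sw : differentiable (fun z : V * V => (z.2, z.1)) (p, q).
    exact: differentiable_pair (ex_diff (is_diff_def := is_diff_snd _))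
      (ex_diff (is_diff_def := is_diff_fst _)).
  have := differentiable_comp sw phiqp.
  by move=> /differentiableN.
pose F := solve phi; pose G := solve psi.
exists [set p | nr p < 2^-1 /\ nr (F p) < 2^-1], [set p | nr p < 2^-1 /\ nr (G p) < 2^-1], F, G.
have lt1 (x : R) : x < 2^-1 -> x < 1 by lra.
have FG p : nr p < 2^-1 -> nr (F p) < 2^-1 -> G (F p) = p.
  move=> p1 f1; apply/esym/(solve_uniq psilip psi0) => //; first exact: lt1.
  by have [_ E] := solveP philip phi0 p1; rewrite /psi /F {1}E addrK.
have GF q : nr q < 2^-1 -> nr (G q) < 2^-1 -> F (G q) = q.
  move=> q1 g1; apply/esym/(solve_uniq philip phi0) => //; first exact: lt1.
  have [_ E] := solveP psilip psi0 q1; rewrite /G {1}E.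
  by rewrite /psi subrK.
split.
- exact: open_nbhs_solve.
- exact: open_nbhs_solve.
- split.
  + by move=> p [p1 _]; apply: solve_diff.
  + by move=> p [p1 _]; apply: solve_diff.
  + by move=> p [/= p1 f1]; rewrite FG.
  + by move=> p [/= p1 f1]; rewrite GF.
- exact: solve0.
- move=> p [/= p1 f1]; split; [exact: lt1 | exact: lt1|].
  by have [] := solveP philip phi0 p1.
Qed.

End Implicit.

(** * Division by a monic quadratic polynomial *)

Section Division.
Variable K : comPzRingType.
Implicit Types (s t x : K).

(** [remc s t k] = (al, be) is the remainder al x + be of x^k modulo
    x^2 + s x - t: multiplying by x sends al x + be to
    al x^2 + be x = al (x^2 + s x - t) + (be - s al) x + t al. *)
Fixpoint remc s t k : K * K :=
  if k is k'.+1 then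
    ((remc s t k').2 - s * (remc s t k').1, t * (remc s t k').1) else (0, 1).

(** The quotient in the same division. *)
Fixpoint quoc s t x k : K :=
  if k is k'.+1 then x * quoc s t x k' + (remc s t k').1 else 0.

Lemma division s t x k :
  x ^+ k = quoc s t x k * (x ^+ 2 + s * x - t) + ((remc s t k).1 * x + (remc s t k).2).
Proof.
elim: k => [|k IH]; first by rewrite expr0 /= !mul0r !add0r.
by rewrite exprS IH /=; ring.
Qed.

Lemma remc00 k : remc 0 0 k.+2 = (0, 0).
Proof. by elim: k => [|k IH]; rewrite /= !(mul0r, subr0) // IH. Qed.

End Division.

(** * Estimates of homogeneous type for monomials and remainders *)

Section Graded.
Variable R : realType.
Implicit Types (u v : C R) (X d : R).

(** Bounds for a function homogeneous of degree k with Lipschitz constant k X^k: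
    u and v are its values at two points at distance d. *)
Definition graded X d (k : nat) u v : Prop :=
  [/\ nr u <= X ^+ k, nr v <= X ^+ k & nr (u - v) <= k%:R * X ^+ k * d].

Lemma graded1 X d : graded X d 0 1 1.
Proof. by split; rewrite ?expr0 ?nr1 // subrr nr0 mul0r mul0r. Qed.

(** Leibniz rule: the degrees add up, also as factors of the Lipschitz constants. *)
Lemma gradedM X d k l u v u' v' : 0 <= X -> 0 <= d ->
  graded X d k u v -> graded X d l u' v' -> graded X d (k + l) (u * u') (v * v').
Proof.
move=> X0 d0 [uk vk uv] [ul vl uv']; split.
- by rewrite nrM exprD ler_pM ?nr_ge0.
- by rewrite nrM exprD ler_pM ?nr_ge0.
have -> : u * u' - v * v' = u * (u' - v') + (u - v) * v' by ring.
apply: le_trans (nrD _ _) _; rewrite !nrM.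
apply: (@le_trans _ _ (X ^+ k * (l%:R * X ^+ l * d) + k%:R * X ^+ k * d * X ^+ l)).
  by rewrite lerD // ler_pM ?nr_ge0.
by rewrite natrD exprD le_eqVlt; apply/orP; left; apply/eqP; ring.
Qed.

Lemma gradedX X d u v k : 0 <= X -> 0 <= d ->
  graded X d 1 u v -> graded X d k (u ^+ k) (v ^+ k).
Proof.
move=> X0 d0 uv; elim: k => [|k IH]; first by rewrite !expr0; apply: graded1.
by rewrite !exprS -add1n; apply: gradedM.
Qed.

Lemma graded_prod (I : Type) (r : seq I) (P : pred I) X d (k : I -> nat) (u v : I -> C R) :
  0 <= X -> 0 <= d -> (forall i, P i -> graded X d (k i) (u i) (v i)) ->
  graded X d (\sum_(i <- r | P i) k i)%N (\prod_(i <- r | P i) u i) (\prod_(i <- r | P i) v i).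
Proof.
move=> X0 d0 uv.
elim/big_rec3: _ => [|i a b c Pi IH]; first exact: graded1.
by apply: gradedM => //; apply: uv.
Qed.

(** The factor k is absorbed by 2^k, so that the bound becomes geometric. *)
Lemma graded_weaken X d k u v : 0 <= X -> 0 <= d -> graded X d k u v ->
  nr (u - v) <= d * (2 * X) ^+ k.
Proof.
move=> X0 d0 [_ _ /le_trans]; apply; rewrite exprMn mulrC.
rewrite ler_wpM2l // ler_wpM2r ?exprn_ge0 //.
by rewrite -natrX ler_nat ltnW // ltn_expl.
Qed.

(** Multiplication by x at most doubles |al| + |be|. *)
Lemma nr_remc (s t : C R) k : nr s <= 1 -> nr t <= 1 ->
  nr (remc s t k).1 + nr (remc s t k).2 <= 2 ^+ k.
Proof.
move=> s1 t1; elim: k => [|k IH]; first by rewrite /= nr0 nr1 add0r expr0.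
rewrite exprS /=; set a := (remc s t k).1 in IH *; set b := (remc s t k).2 in IH *.
have H1 := nrB b (s * a); rewrite nrM in H1; rewrite nrM.
have H2 : nr s * nr a <= nr a by rewrite -[leRHS]mul1r ler_wpM2r ?nr_ge0.
have H3 : nr t * nr a <= nr a by rewrite -[leRHS]mul1r ler_wpM2r ?nr_ge0.
have := nr_ge0 b; lra.
Qed.

Lemma remc_lip (s t s' t' : C R) d k :
  nr s <= 1 -> nr t <= 1 -> nr s' <= 1 -> nr t' <= 1 ->
  nr (s - s') <= d -> nr (t - t') <= d ->
  nr ((remc s t k).1 - (remc s' t' k).1) + nr ((remc s t k).2 - (remc s' t' k).2)
    <= k%:R * 2 ^+ k * d.
Proof.
move=> s1 t1 s1' t1' sd td.
have d0 : 0 <= d := le_trans (nr_ge0 _) sd.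
elim: k => [|k IH]; first by rewrite /= !subrr !nr0 addr0 mul0r mul0r.
have := nr_remc k s1' t1'.
rewrite exprS /=; set a := (remc s t k).1 in IH *; set b := (remc s t k).2 in IH *.
set a' := (remc s' t' k).1 in IH *; set b' := (remc s' t' k).2 in IH * => ab.
have -> : b - s * a - (b' - s' * a') = (b - b') - (s * (a - a') + (s - s') * a') by ring.
have -> : t * a - t' * a' = t * (a - a') + (t - t') * a' by ring.
have H1 := nrB (b - b') (s * (a - a') + (s - s') * a').
have H2 := nrD (s * (a - a')) ((s - s') * a'); rewrite !nrM in H2.
have H3 := nrD (t * (a - a')) ((t - t') * a'); rewrite !nrM in H3.
have H4 : nr s * nr (a - a') <= nr (a - a') by rewrite -[leRHS]mul1r ler_wpM2r ?nr_ge0.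
have H5 : nr t * nr (a - a') <= nr (a - a') by rewrite -[leRHS]mul1r ler_wpM2r ?nr_ge0.
have H6 : nr (s - s') * nr a' <= d * 2 ^+ k.
  by apply: ler_pM; rewrite ?nr_ge0 //; have := nr_ge0 b'; lra.
have H7 : nr (t - t') * nr a' <= d * 2 ^+ k.
  by apply: ler_pM; rewrite ?nr_ge0 //; have := nr_ge0 b'; lra.
have -> : k.+1%:R * (2 * 2 ^+ k) * d = 2 * (k%:R * 2 ^+ k * d) + 2 * (d * 2 ^+ k).
  by rewrite -natr1; ring.
have := nr_ge0 (b - b'); lra.
Qed.

(** With X = 2, the remainders obey the same kind of bounds as monomials, and can be
    multiplied with them. *)
Lemma graded_remc (s t s' t' : C R) d k :
  nr s <= 1 -> nr t <= 1 -> nr s' <= 1 -> nr t' <= 1 ->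
  nr (s - s') <= d -> nr (t - t') <= d ->
  graded 2 d k (remc s t k).1 (remc s' t' k).1 /\
  graded 2 d k (remc s t k).2 (remc s' t' k).2.
Proof.
move=> s1 t1 s1' t1' sd td.
have := nr_remc k s1 t1; have := nr_remc k s1' t1'.
have := remc_lip k s1 t1 s1' t1' sd td.
rewrite /graded; move: (k%:R * 2 ^+ k * d) (2 ^+ k) => D T.
have := nr_ge0 ((remc s t k).1 - (remc s' t' k).1).
have := nr_ge0 ((remc s t k).2 - (remc s' t' k).2).
have := nr_ge0 (remc s t k).1; have := nr_ge0 (remc s t k).2.
have := nr_ge0 (remc s' t' k).1; have := nr_ge0 (remc s' t' k).2.
by move=> *; split; split; lra.
Qed.

Lemma nr_quoc (s t x : C R) k : nr s <= 1 -> nr t <= 1 -> nr x <= 1 ->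
  nr (quoc s t x k) <= 2 ^+ k.
Proof.
move=> s1 t1 x1; elim: k => [|k IH]; first by rewrite /= nr0 ler01.
rewrite exprS /=; have := nrD (x * quoc s t x k) (remc s t k).1; rewrite nrM.
have H : nr x * nr (quoc s t x k) <= nr (quoc s t x k).
  by rewrite -[leRHS]mul1r ler_wpM2r ?nr_ge0.
have := nr_remc k s1 t1; have := nr_ge0 (remc s t k).2; lra.
Qed.

Lemma differentiable_prodK (K : numFieldType) (V : normedModType K) (I : Type) (r : seq I)
    (P : pred I) (f : I -> V -> K) (x : V) :
  (forall i, differentiable (f i) x) ->
  differentiable (fun y => \prod_(i <- r | P i) f i y) x.
Proof.
move=> fd; elim: r => [|i r IH].
  have -> : (fun y => \prod_(i <- [::] | P i) f i y) = cst 1.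
    by apply/funext => y; rewrite big_nil.
  exact: differentiable_cst.
have [Pi|Pi] := boolP (P i); last first.
  have -> : (fun y => \prod_(i <- i :: r | P i) f i y) = (fun y => \prod_(i <- r | P i) f i y).
    by apply/funext => y; rewrite big_cons (negbTE Pi).
  exact: IH.
have -> : (fun y => \prod_(i <- i :: r | P i) f i y) =
    f i * (fun y => \prod_(i <- r | P i) f i y).
  by apply/funext => y; rewrite big_cons Pi.
exact: differentiableM.
Qed.

Lemma differentiable_pow (K : numFieldType) (V : normedModType K) (f : V -> K) (x : V) k :
  differentiable f x -> differentiable (fun y => f y ^+ k) x.
Proof.
move=> fd; elim: k => [|k IH]; first exact: differentiable_cst.
have -> : (fun y => f y ^+ k.+1) = f * (fun y => f y ^+ k).
  by apply/funext => y; rewrite exprS.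
exact: differentiableM.
Qed.

Lemma differentiable_remc (K : numFieldType) (V : normedModType K) (s t : V -> K) (x : V) k :
  differentiable s x -> differentiable t x ->
  differentiable (fun y => (remc (s y) (t y) k).1) x /\
  differentiable (fun y => (remc (s y) (t y) k).2) x.
Proof.
move=> sd td; elim: k => [|k [IH1 IH2]] /=.
  by split; apply: differentiable_cst.
split; first exact: (differentiableB IH2 (differentiableM sd IH1)).
exact: (differentiableM td IH1).
Qed.

End Graded.

(** * Normal form when the remainder is small *)

Definition monom (R : realType) m (a : {ffun 'I_m -> nat}) (x : 'rV[C R]_m) : C R :=
  \prod_i x 0 i ^+ a i.

Section SmallRemainder.
Variables (R : realType) (n : nat) (n_ge2 : (2 <= n)%N).
Local Notation V := 'rV[C R]_n.+1.
Implicit Types (p q : V) (a : {ffun 'I_n.+1 -> nat}).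

Let i0 : 'I_n.+1 := inord 0.
Let i1 : 'I_n.+1 := inord 1.

Lemma i0_max : (i0 == ord_max) = false.
Proof. by apply/negbTE; rewrite -val_eqE /= inordK // eq_sym -lt0n (leq_trans _ n_ge2). Qed.

Lemma i1_max : (i1 == ord_max) = false.
Proof.
apply/negbTE; rewrite -val_eqE /= inordK; last by rewrite ltnS (leq_trans _ n_ge2).
by rewrite neq_ltn n_ge2.
Qed.

Lemma i0_i1 : (i0 == i1) = false.
Proof.
by apply/negbTE; rewrite -val_eqE /= !inordK // ltnS (leq_trans _ n_ge2).
Qed.

(** The monomial in z alone; the last variable of the remainder r, conj z_1, is the
    one in which the division takes place. *)
Definition zmonom a p : C R := \prod_(i | i != ord_max) p 0 i ^+ a i.

Lemma monom_split a p : monom a p = zmonom a p * p 0 ord_max ^+ a ord_max.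
Proof. by rewrite /monom (bigD1 ord_max) //= mulrC. Qed.

Lemma deg_split a : deg a = (\sum_(i | i != ord_max) a i + a ord_max)%N.
Proof. by rewrite /deg (bigD1 ord_max) //= addnC. Qed.

Lemma zmonom_conj a p : zmonom a (z_conj1 p) = zmonom a p.
Proof. by apply: eq_bigr => i ni; rewrite z_conj1E (negbTE ni). Qed.

Lemma graded_zmonom a p p' d : nr p < 1 -> nr p' < 1 -> nr (p - p') <= d ->
  graded 2 d (\sum_(i | i != ord_max) a i)%N (zmonom a p) (zmonom a p').
Proof.
move=> p1 p1' pd; have d0 : 0 <= d := le_trans (nr_ge0 _) pd.
apply: graded_prod => // i _; apply: gradedX => //.
have := nr_coord p i; have := nr_coord p' i; have := nr_coord (p - p') i.
by rewrite !mxE => *; split; rewrite ?expr1; lra.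
Qed.

(** [lin_term], [cst_term] and [quo_term] are the linear and constant coefficients
    of the remainder and the quotient of z^a' xi^k, where a = (a', k), in the division
    by xi^2 + s xi - t.  Here z is read from p, and the parameters s and t are the
    coordinates of q of index 1 and n: those that will correspond to z_2 and w. *)
Definition lin_term a p q : C R := zmonom a p * (remc (q 0 i1) (q 0 ord_max) (a ord_max)).1.
Definition cst_term a p q : C R := zmonom a p * (remc (q 0 i1) (q 0 ord_max) (a ord_max)).2.
Definition quo_term a p q (x : C R) : C R :=
  zmonom a p * quoc (q 0 i1) (q 0 ord_max) x (a ord_max).

Lemma graded_terms a p q p' q' : nr p < 1 -> nr q < 1 -> nr p' < 1 -> nr q' < 1 ->
  graded 2 (nr (p - p') + nr (q - q')) (deg a) (lin_term a p q) (lin_term a p' q') /\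
  graded 2 (nr (p - p') + nr (q - q')) (deg a) (cst_term a p q) (cst_term a p' q').
Proof.
move=> p1 q1 p1' q1'; set d := _ + _.
have pd : nr (p - p') <= d by rewrite lerDl nr_ge0.
have qd : nr (q - q') <= d by rewrite lerDr nr_ge0.
have d0 : 0 <= d := le_trans (nr_ge0 _) pd.
have H := graded_zmonom a p1 p1' pd.
have q_le i : nr (q 0 i) <= 1 by have := nr_coord q i; lra.
have q_le' i : nr (q' 0 i) <= 1 by have := nr_coord q' i; lra.
have qd_le i : nr (q 0 i - q' 0 i) <= d by have := nr_coord (q - q') i; rewrite !mxE; lra.
have [H1 H2] := graded_remc (a ord_max) (q_le i1) (q_le ord_max) (q_le' i1) (q_le' ord_max)
   (qd_le i1) (qd_le ord_max).
by rewrite deg_split; split; apply: gradedM.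
Qed.

Lemma nr_terms a p q : nr p < 1 -> nr q < 1 ->
  nr (lin_term a p q) <= 1 * 4 ^+ deg a /\ nr (cst_term a p q) <= 1 * 4 ^+ deg a.
Proof.
move=> p1 q1; have [[H1 _ _] [H2 _ _]] := graded_terms a p1 q1 p1 q1.
have H : 2 ^+ deg a <= 4 ^+ deg a :> R by rewrite lerXn2r ?nnegrE //; lra.
by rewrite mul1r; split; [apply: le_trans H1 _ | apply: le_trans H2 _].
Qed.

Lemma nr_terms_lip a p q p' q' : nr p < 1 -> nr q < 1 -> nr p' < 1 -> nr q' < 1 ->
  nr (lin_term a p q - lin_term a p' q') <= (nr (p - p') + nr (q - q')) * 4 ^+ deg a /\
  nr (cst_term a p q - cst_term a p' q') <= (nr (p - p') + nr (q - q')) * 4 ^+ deg a.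
Proof.
move=> p1 q1 p1' q1'; have [H1 H2] := graded_terms a p1 q1 p1' q1'.
have -> : 4 = 2 * 2 :> R by ring.
by split; apply: graded_weaken; rewrite ?addr_ge0 ?nr_ge0.
Qed.

Lemma nr_quo_term a p q x : nr p < 1 -> nr q < 1 -> nr x <= 1 ->
  nr (quo_term a p q x) <= 1 * 4 ^+ deg a.
Proof.
move=> p1 q1 x1; rewrite mul1r nrM.
have pp : nr (p - p) <= 0 by rewrite subrr nr0.
have [H _ _] := graded_zmonom a p1 p1 pp.
have q_le i : nr (q 0 i) <= 1 by have := nr_coord q i; lra.
apply: (@le_trans _ _ (2 ^+ deg a)).
  by rewrite deg_split exprD ler_pM ?nr_ge0 // nr_quoc.
by rewrite lerXn2r ?nnegrE //; lra.
Qed.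

Lemma monom_division a p q x :
  zmonom a p * x ^+ a ord_max =
  (x ^+ 2 + q 0 i1 * x - q 0 ord_max) * quo_term a p q x + (x * lin_term a p q + cst_term a p q).
Proof. by rewrite (division (q 0 i1) (q 0 ord_max)) /quo_term /lin_term /cst_term; ring. Qed.

Lemma differentiable_terms a p q :
  differentiable (fun z : V * V => lin_term a z.1 z.2) (p, q) /\
  differentiable (fun z : V * V => cst_term a z.1 z.2) (p, q).
Proof.
have cd1 i : differentiable (fun z : V * V => z.1 0 i : C R) (p, q).
  exact: (differentiable_comp (ex_diff (is_diff_def := is_diff_fst (p, q)))
           (ex_diff (is_diff_def := is_diff_coord p i))).
have cd2 i : differentiable (fun z : V * V => z.2 0 i : C R) (p, q).
  exact: (differentiable_comp (ex_diff (is_diff_def := is_diff_snd (p, q)))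
           (ex_diff (is_diff_def := is_diff_coord q i))).
have zd : differentiable (fun z : V * V => zmonom a z.1) (p, q).
  apply: (@differentiable_prodK _ _ _ _ _ (fun i (z : V * V) => z.1 0 i ^+ a i)) => i.
  exact: (differentiable_pow (a i) (cd1 i)).
have [r1 r2] := differentiable_remc (a ord_max) (cd2 i1) (cd2 ord_max).
by split; [exact: (differentiableM zd r1)|exact: (differentiableM zd r2)].
Qed.

Variables (c : {ffun 'I_n.+1 -> nat} -> C R) (K s : R) (r : V -> C R).
Hypotheses (s0 : 0 <= s) (cK : forall k, cnorm c k <= K * s ^+ k).
Hypotheses (s4 : s * 4 < 1) (Ks : K * (s * 4) ^+ 3 / (1 - s * 4) <= 4^-1).
Hypothesis c3 : no_terms_below c 3.
Hypothesis r_sum : forall x, nr x < 1 -> sums (hsum c (fun a => monom a x)) (r x).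

Let four0 : 0 <= 4 :> R. Proof. by []. Qed.

(** Quantitative form of the smallness of the remainder: a bound B 4^deg on the
    terms gives the bound B / 4 on the sum. *)
Lemma small_bound (e : {ffun 'I_n.+1 -> nat} -> C R) (S : C R) B :
  0 <= B -> (forall a, nr (e a) <= B * 4 ^+ deg a) -> sums (hsum c e) S -> nr S <= 4^-1 * B.
Proof.
move=> B0 eB eS; rewrite -(gsum_eq eS).
apply: le_trans (gsum_bound s0 cK four0 s4 c3 eB) _.
have -> : K * B * (s * 4) ^+ 3 / (1 - s * 4) = K * (s * 4) ^+ 3 / (1 - s * 4) * B by ring.
by rewrite ler_wpM2r.
Qed.

Definition lin_sum p q := gsum c (fun a => lin_term a p q).
Definition cst_sum p q := gsum c (fun a => cst_term a p q).

Lemma lin_sumP p q : nr p < 1 -> nr q < 1 -> sums (hsum c (fun a => lin_term a p q)) (lin_sum p q).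
Proof. by move=> p1 q1; apply: (gsumP s0 cK four0 s4) => a; exact: (nr_terms a p1 q1).1. Qed.

Lemma cst_sumP p q : nr p < 1 -> nr q < 1 -> sums (hsum c (fun a => cst_term a p q)) (cst_sum p q).
Proof. by move=> p1 q1; apply: (gsumP s0 cK four0 s4) => a; exact: (nr_terms a p1 q1).2. Qed.

Lemma gsum_lip (e e' : {ffun 'I_n.+1 -> nat} -> C R) S S' d : 0 <= d ->
  (forall a, nr (e a - e' a) <= d * 4 ^+ deg a) ->
  sums (hsum c e) S -> sums (hsum c e') S' -> nr (S - S') <= 4^-1 * d.
Proof.
move=> d0 ed eS eS'.
have E : (fun a => e a - e' a) = (fun a => -1 * e' a + e a).
  by apply/funext => a; rewrite mulN1r addrC.
have := gsum_lin (u := -1) eS' eS; rewrite -E mulN1r addrC.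
exact: small_bound.
Qed.

(** The system s = z_2 + A, t = w - B for the new coordinates is
    q = p + displacement p q; the coordinates other than z_2 and w do not move. *)
Definition displacement p q : V :=
  \row_i (if i == i1 then lin_sum p q else if i == ord_max then - cst_sum p q else 0).

(** Smallness of the series A and B turns into the contraction constant 1/4. *)
Lemma displacement_lip p q p' q' : nr p < 1 -> nr q < 1 -> nr p' < 1 -> nr q' < 1 ->
  nr (displacement p q - displacement p' q') <= 4^-1 * (nr (p - p') + nr (q - q')).
Proof.
move=> p1 q1 p1' q1'.
have d0 : 0 <= nr (p - p') + nr (q - q') by rewrite addr_ge0 ?nr_ge0.
apply: nr_rV_le => [|i]; first by rewrite mulr_ge0 // invr_ge0.
rewrite !mxE; case: ifP => _.
  apply: (gsum_lip d0 _ (lin_sumP p1 q1) (lin_sumP p1' q1')) => a.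
  exact: (nr_terms_lip a p1 q1 p1' q1').1.
case: ifP => _; last by rewrite subrr nr0 mulr_ge0 // invr_ge0.
rewrite -opprD nrN.
apply: (gsum_lip d0 _ (cst_sumP p1 q1) (cst_sumP p1' q1')) => a.
exact: (nr_terms_lip a p1 q1 p1' q1').2.
Qed.

(** At the origin the divisor is xi^2, and in degree at least 3 a monomial either
    contains some z_i or is divisible by xi^2. *)
Lemma terms00 a : (3 <= deg a)%N -> lin_term a 0 0 = 0 /\ cst_term a 0 0 = 0.
Proof.
rewrite deg_split /lin_term /cst_term !mxE.
case: (pickP (fun i => (i != ord_max) && (a i != 0%N))) => [i /andP[ni ai] _|H]; last first.
  rewrite big1 => [|i ni]; last by have := H i; rewrite ni /= => /negbFE/eqP.
  rewrite add0n; case: (a ord_max) => [|[|k]] // _.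
  by rewrite remc00 /= !mulr0.
suff -> : zmonom a 0 = 0 by rewrite !mul0r.
by rewrite /zmonom (bigD1 i) //= mxE expr0n (negbTE ai) mul0r.
Qed.

Lemma displacement00 : displacement 0 0 = 0.
Proof.
have S0 (e : {ffun 'I_n.+1 -> nat} -> C R) : (forall a, (3 <= deg a)%N -> e a = 0) ->
    gsum c e = 0.
  move=> e0; apply: gsum_eq.
  have -> : hsum c e = (fun=> 0).
    apply/funext => k; apply: big1 => a _.
    set b := [ffun i => _]; have [b3|b3] := leqP 3 (deg b); first by rewrite e0 // mulr0.
    by rewrite c3 // mul0r.
  rewrite /sums; have -> : series (fun=> 0 : C R) = cst 0 by apply/funext => N; apply: big1.
  exact: cvg_cst.
apply/rowP => i; rewrite !mxE.
rewrite /lin_sum S0; last by move=> a /terms00[].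
rewrite /cst_sum S0; last by move=> a /terms00[].
by rewrite oppr0; case: (i == i1); case: (i == ord_max).
Qed.

Lemma lt1_near p : nr p < 1 -> exists2 d : R, 0 < d & forall y : V, nr (y - p) < d -> nr y < 1.
Proof.
move=> p1; exists (1 - nr p); first by rewrite subr_gt0.
by move=> y; have := nrD (y - p) p; rewrite subrK; lra.
Qed.

Lemma displacement_diff p q : nr p < 1 -> nr q < 1 ->
  differentiable (fun z : V * V => displacement z.1 z.2) (p, q).
Proof.
move=> p1 q1.
have near1 : \forall z \near (p, q), nr z.1 < 1 /\ nr z.2 < 1.
  have [d d0 dP] := lt1_near p1; have [d' d0' dP'] := lt1_near q1.
  apply/near_nr; exists (Order.min d d') => [|z]; first by rewrite lt_min d0.
  rewrite nr_pair /= gt_max !lt_min => /andP[/andP[/= H1 _] /andP[_ H2]].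
  by split; [apply: dP|apply: dP'].
have nrz (z : V * V) : nr (z.1 - p) + nr (z.2 - q) <= 2 * nr (z - (p, q)).
  by have := nr_fst (z - (p, q)); have := nr_snd (z - (p, q)) => /=; lra.
have X0 : forall a, 0 <= 4 ^+ deg a :> R by move=> a; rewrite exprn_ge0.
have gAd : differentiable (fun z : V * V => lin_sum z.1 z.2) (p, q).
  apply: (proj1 (gsum_diff (B := 2) s0 cK four0 s4 _ _ _)).
  - by move=> a; exact: (differentiable_terms a p q).1.
  - apply: filterS near1 => z [z1 z2] a.
    by have := (nr_terms a z1 z2).1; have := X0 a; lra.
  - apply: filterS near1 => z [z1 z2] a.
    apply: le_trans (nr_terms_lip a z1 z2 p1 q1).1 _.
    by rewrite ler_wpM2r.
have gBd : differentiable (fun z : V * V => cst_sum z.1 z.2) (p, q).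
  apply: (proj1 (gsum_diff (B := 2) s0 cK four0 s4 _ _ _)).
  - by move=> a; exact: (differentiable_terms a p q).2.
  - apply: filterS near1 => z [z1 z2] a.
    by have := (nr_terms a z1 z2).2; have := X0 a; lra.
  - apply: filterS near1 => z [z1 z2] a.
    apply: le_trans (nr_terms_lip a z1 z2 p1 q1).2 _.
    by rewrite ler_wpM2r.
apply: differentiable_rV => i.
have [ii|ii] := boolP (i == i1).
  have -> : (fun z : V * V => displacement z.1 z.2 0 i) = (fun z => lin_sum z.1 z.2).
    by apply/funext => z; rewrite mxE ii.
  exact: gAd.
have [ij|ij] := boolP (i == ord_max).
  have -> : (fun z : V * V => displacement z.1 z.2 0 i) = - (fun z => cst_sum z.1 z.2).
    by apply/funext => z; rewrite mxE (negbTE ii) ij.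
  exact: differentiableN gBd.
have -> : (fun z : V * V => displacement z.1 z.2 0 i) = cst 0.
  by apply/funext => z; rewrite mxE (negbTE ii) (negbTE ij).
exact: differentiable_cst.
Qed.

(** The identity f - w = (xi^2 + s xi - t) (1 + Q), with |Q| < 1 so that the last
    factor does not vanish. *)
Lemma quadric_graph_iff p q : nr p < 1 -> nr q < 1 -> q = p + displacement p q ->
  (p 0 ord_max = quadratic_part p + r (z_conj1 p)) <-> (q 0 ord_max = quadratic_part q).
Proof.
move=> p1 q1 qE.
have q_i0 : q 0 i0 = p 0 i0 by rewrite qE !mxE i0_i1 i0_max addr0.
have q_i1 : q 0 i1 = p 0 i1 + lin_sum p q by rewrite {1}qE !mxE eqxx.
have q_max : q 0 ord_max = p 0 ord_max - cst_sum p q by rewrite {1}qE !mxE eq_sym i1_max eqxx.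
rewrite !quadratic_partE -/i0 -/i1 q_i0; set x := cj (p 0 i0).
have x1 : nr x < 1 by rewrite nr_conj; have := nr_coord p i0; lra.
have z1 : nr (z_conj1 p) < 1.
  apply: nr_rV_lt => // i; rewrite z_conj1E; case: ifP => _ //.
  by have := nr_coord p i; lra.
have [S SQ] : exists S, sums (hsum c (fun a => quo_term a p q x)) S.
  exists (gsum c (fun a => quo_term a p q x)); apply: (gsumP s0 cK four0 s4) => a.
  exact: nr_quo_term p1 q1 (ltW x1).
have S1 : nr S < 1.
  have := @small_bound (fun a => quo_term a p q x) S 1 ler01 (fun a => nr_quo_term a p1 q1 (ltW x1)) SQ.
  lra.
have rE : r (z_conj1 p) =
    (x ^+ 2 + q 0 i1 * x - q 0 ord_max) * S + (x * lin_sum p q + cst_sum p q).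
  apply: (sums_uniq (r_sum z1)).
  have -> : (fun a => monom a (z_conj1 p)) = (fun a =>
      (x ^+ 2 + q 0 i1 * x - q 0 ord_max) * quo_term a p q x + (x * lin_term a p q + cst_term a p q)).
    apply/funext => a; rewrite monom_split zmonom_conj z_conj1E eqxx -/i0 -/x.
    exact: monom_division.
  exact: (gsum_lin SQ (gsum_lin (lin_sumP p1 q1) (cst_sumP p1 q1))).
rewrite rE.
(* w - f = (t - s x - x^2) (1 + Q), where S is the value of Q. *)
have key : p 0 ord_max - (x * p 0 i1 + x ^+ 2 +
      ((x ^+ 2 + q 0 i1 * x - q 0 ord_max) * S + (x * lin_sum p q + cst_sum p q)))
   = (q 0 ord_max - (x * q 0 i1 + x ^+ 2)) * (1 + S).
  by rewrite q_max q_i1; ring.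
have S10 : 1 + S != 0.
  apply/eqP => S0; have SE : S = -1 by rewrite -[S](addKr 1) S0 addr0.
  by move: S1; rewrite SE nrN nr1 ltxx.
split=> [/eqP|] E.
  move: E; rewrite -subr_eq0 key mulf_eq0 (negbTE S10) orbF subr_eq0 => /eqP //.
by apply/eqP; rewrite -subr_eq0 key E subrr mul0r.
Qed.

Theorem quadric_equiv_small : exists (U W : set V) (F G : V -> V),
  [/\ open_nbhs (0 : V) U, open_nbhs (0 : V) W, biholomorphism U W F G, F 0 = 0 &
      forall p, U p -> nr p < 1 /\
        ((p 0 ord_max = quadratic_part p + r (z_conj1 p)) <->
         (F p 0 ord_max = quadratic_part (F p)))].
Proof.
have [U [W [F [G [U0 W0 FG F0 FP]]]]] := implicit_biholomorphism displacement_lip displacement00 displacement_diff.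
exists U, W, F, G; split=> // p /FP [p1 Fp1 FE]; split=> //.
exact: quadric_graph_iff.
Qed.

End SmallRemainder.

(** * Coefficients of a convergent power series *)

Section PowerSeries.
Variables (R : realType) (m : nat) (c : {ffun 'I_m -> nat} -> C R) (rho : R) (r : 'rV[C R]_m -> C R).
Hypothesis cr : is_pseries_sum c rho r.

Lemma homog_part_hsum (x : 'rV[C R]_m) : homog_part c x = hsum c (fun a => monom a x).
Proof.
apply/funext => k; apply: eq_bigr => a _; congr (_ * _).
by apply: eq_bigr => i _; rewrite ffunE.
Qed.

Lemma pseries_sums (x : 'rV[C R]_m) : (forall i, nr (x 0 i) < rho) ->
  sums (hsum c (fun a => monom a x)) (r x).
Proof. by move=> xr; have [_ _ /(_ x xr)] := is_pseries_sumE cr; rewrite homog_part_hsum. Qed.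

Lemma homog_part_norm k :
  homog_part (fun a => `|c a|) (const_mx (rc rho)) k = rc (cnorm c k * rho ^+ k).
Proof.
rewrite rcM /homog_part mulrC.
have rcs : {morph @rc R : x y / x + y >-> x + y} := @rcD R.
rewrite (big_morph _ rcs (@rc0 R)) mulr_sumr; apply: eq_bigr => a /eqP ak.
rewrite nrE mulrC; congr (_ * _).
under eq_bigr do rewrite mxE.
by rewrite prodrXr ak rcX.
Qed.

(** The terms of the convergent series of the |c_a| rho^|a| are bounded. *)
Lemma cnorm_geo : exists2 K : R, 0 <= K & forall k, cnorm c k <= K * rho^-1 ^+ k.
Proof.
have [rho0 cc _] := is_pseries_sumE cr.
have /cvg_nr /(_ 1 ltr01) [N _ NP] := cvg_series_cvg_0 cc.
pose K := \sum_(k < N) cnorm c k * rho ^+ k + 1.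
have T0 k : 0 <= cnorm c k * rho ^+ k by rewrite mulr_ge0 ?cnorm_ge0 // exprn_ge0 // ltW.
exists K => [|k]; first by rewrite addr_ge0 // sumr_ge0.
rewrite exprVn ler_pdivlMr ?exprn_gt0 //.
have [kN|kN] := ltnP k N.
  by rewrite /K (bigD1 (Ordinal kN)) //= -addrA lerDl addr_ge0 // sumr_ge0.
have := NP k kN; rewrite subr0 homog_part_norm nr_rc ger0_norm // => /le_trans; apply.
by rewrite lerDr sumr_ge0.
Qed.

End PowerSeries.

(** * Reduction to a small remainder by a weighted dilation *)

Section Scaling.
Variables (R : realType) (n : nat) (n_ge2 : (2 <= n)%N).
Local Notation V := 'rV[C R]_n.+1.
Implicit Types (p q : V) (e : R).

(** The dilation with weight 1 for z and 2 for w, for which the quadric is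
    homogeneous. *)
Definition dil e p : V :=
  \row_i (if i == ord_max then rc (e ^+ 2) * p 0 i else rc e * p 0 i).

Lemma rcK e (x : C R) : e != 0 -> rc e * (rc e^-1 * x) = x.
Proof. by move=> e0; rewrite mulrA -rcM divff // rc1 mul1r. Qed.

Lemma dilK e p : e != 0 -> dil e (dil e^-1 p) = p.
Proof.
move=> e0; apply/rowP => i; rewrite !mxE; case: (i == ord_max); last exact: rcK.
by rewrite exprVn rcK // expf_eq0.
Qed.

Lemma dilVK e p : e != 0 -> dil e^-1 (dil e p) = p.
Proof. by move=> e0; rewrite -{2}[e]invrK dilK // invr_eq0. Qed.

Lemma dil_linear e : linear (dil e).
Proof. by move=> a u v; apply/rowP => i; rewrite !mxE; case: ifP => _; ring. Qed.

Lemma differentiable_dil e p : differentiable (dil e) p.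
Proof.
have H : is_diff p (dil e) (dil e); last exact: (ex_diff (is_diff_def := H)).
apply: (@is_diff_bounded_linear _ _ _ _ p (`|e| + e ^+ 2)) => [|h]; first exact: dil_linear.
have e20 : 0 <= e ^+ 2 by rewrite sqr_ge0.
apply: nr_rV_le => [|i]; first by rewrite mulr_ge0 ?nr_ge0 // addr_ge0.
rewrite mxE; case: ifP => _; rewrite nrM nr_rc ler_pM ?nr_ge0 ?nr_coord //.
  by rewrite ger0_norm // lerDr.
by rewrite lerDl.
Qed.

Lemma dil0 e : dil e 0 = 0.
Proof. by apply/rowP => i; rewrite !mxE !mulr0; case: ifP. Qed.

Lemma z_conj1_dil e p : z_conj1 (dil e p) = rc e *: z_conj1 p.
Proof.
apply/rowP => i; rewrite !z_conj1E [RHS]mxE z_conj1E !mxE.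
by have [_|_] := eqVneq i ord_max; rewrite ?(i0_max n_ge2) // cjM cj_rc.
Qed.

Lemma quadratic_part_dil e p : quadratic_part (dil e p) = rc (e ^+ 2) * quadratic_part p.
Proof.
rewrite !quadratic_partE !mxE (i0_max n_ge2) (i1_max n_ge2) cjM cj_rc rcX.
by ring.
Qed.

Lemma quadric_dil e p : e != 0 -> quadric (dil e p) <-> quadric p.
Proof.
move=> e0; rewrite /quadric /= /wcoord quadratic_part_dil mxE eqxx.
have e20 : rc (e ^+ 2) != 0 by rewrite -rc0 (inj_eq (@rc_inj R)) expf_eq0.
by split=> [/(mulfI e20)|->].
Qed.

Lemma monom_scale e (a : {ffun 'I_n.+1 -> nat}) (x : V) :
  monom a (rc e *: x) = rc (e ^+ deg a) * monom a x.
Proof.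
rewrite /monom rcX /deg -prodrXr -big_split /=; apply: eq_bigr => i _.
by rewrite mxE exprMn.
Qed.

Variables (c : {ffun 'I_n.+1 -> nat} -> C R) (rho : R) (r : V -> C R).
Hypotheses (cr : is_pseries_sum c rho r) (c3 : no_terms_below c 3).

(** Coefficients of e^-2 r(e x), the remainder in the dilated coordinates. *)
Definition scaled_coef e (a : {ffun 'I_n.+1 -> nat}) : C R := rc (e^-1 ^+ 2 * e ^+ deg a) * c a.
Definition scaled_sum e (x : V) : C R := rc (e^-1 ^+ 2) * r (rc e *: x).

Lemma scaled_sums e x : 0 < e -> e < rho -> nr x < 1 ->
  sums (hsum (scaled_coef e) (fun a => monom a x)) (scaled_sum e x).
Proof.
move=> e0 er x1.
have xe i : nr ((rc e *: x) 0 i) < rho.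
  rewrite mxE nrM nr_rc gtr0_norm //; apply: le_lt_trans er.
  rewrite -[leRHS]mulr1 ler_wpM2l ?ltW //.
  exact: le_lt_trans (nr_coord x i) x1.
have -> : hsum (scaled_coef e) (fun a => monom a x) =
   hsum c (fun a => rc (e^-1 ^+ 2) * monom a (rc e *: x) + 0).
  apply/funext => k; apply: eq_bigr => a _.
  by rewrite /scaled_coef monom_scale rcM addr0; ring.
have z : sums (hsum c (fun=> 0)) 0.
  rewrite /sums; have -> : series (hsum c (fun=> 0)) = cst 0.
    by apply/funext => N; apply: big1 => k _; apply: big1 => a _; rewrite mulr0.
  exact: cvg_cst.
have := gsum_lin (u := rc (e^-1 ^+ 2)) (pseries_sums cr xe) z.
by rewrite addr0.
Qed.

Lemma scaled_cnorm e k : 0 < e -> cnorm (scaled_coef e) k = e^-1 ^+ 2 * e ^+ k * cnorm c k.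
Proof.
move=> e0; rewrite mulr_sumr; apply: eq_bigr => a /eqP ak.
rewrite /scaled_coef nrM nr_rc degE ak ger0_norm //.
by rewrite mulr_ge0 ?exprn_ge0 ?invr_ge0 // ltW.
Qed.

(** The parts of degree at least 3 are multiplied by e^(k-2), hence by at most e for
    e <= 1, and the sum tends to 0 with e.  The bound 1/4 is the one needed for the
    contraction, the factor 4 the growth of the terms of the division. *)
Lemma scaled_small : exists e K s : R, [/\ 0 < e, e < rho, 0 <= s,
   forall k, cnorm (scaled_coef e) k <= K * s ^+ k & s * 4 < 1 /\ K * (s * 4) ^+ 3 / (1 - s * 4) <= 4^-1].
Proof.
have [rho0 _ _] := is_pseries_sumE cr.
have [K K0 cK] := cnorm_geo cr.
(* The bounds below are 8 e <= rho and 512 e K <= rho^3; they give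
   4 s <= 1/2 and K (4 s)^3 <= 1/8, for the new values of K and s. *)
have [A [A0 AE]] : exists A : R, 0 < A /\ A = 512 by exists 512; split; first lra.
pose e := rho ^+ 3 / (A * K + 8 * rho ^+ 2).
have r2 : 0 < rho ^+ 2 by rewrite exprn_gt0.
have den0 : 0 < A * K + 8 * rho ^+ 2 by rewrite ltr_wpDl ?mulr_ge0 ?(ltW A0) ?mulr_gt0.
have e0 : 0 < e by rewrite divr_gt0 // exprn_gt0.
have eE : e * (A * K + 8 * rho ^+ 2) = rho ^+ 3 by rewrite /e divfK // gt_eqF.
have e8 : 8 * e <= rho.
  rewrite -(ler_pM2r r2) -[rho * _]exprS -eE.
  have := mulr_ge0 (ltW A0) (mulr_ge0 (ltW e0) K0); lra.
have eK : A * (e * K) <= rho ^+ 3.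
  rewrite -eE; have := mulr_ge0 (ltW e0) (ltW r2); lra.
exists e, (K * e^-1 ^+ 2), (e / rho); split.
- exact: e0.
- lra.
- by rewrite divr_ge0 // ltW.
- move=> k; rewrite scaled_cnorm //.
  have -> : K * e^-1 ^+ 2 * (e / rho) ^+ k = e^-1 ^+ 2 * e ^+ k * (K * rho^-1 ^+ k).
    by rewrite exprMn; ring.
  by rewrite ler_wpM2l // mulr_ge0 ?exprn_ge0 ?invr_ge0 // ltW.
have s8 : e / rho <= 8^-1 by rewrite ler_pdivrMr //; lra.
split; first lra.
have d1 : 0 < 1 - e / rho * 4 by lra.
rewrite ler_pdivrMr //.
have -> : K * e^-1 ^+ 2 * (e / rho * 4) ^+ 3 = 64 * (e * K) / rho ^+ 3.
  by field; rewrite !gt_eqF.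
move: eK; rewrite AE => eK.
have : 64 * (e * K) / rho ^+ 3 <= 8^-1 by rewrite ler_pdivrMr ?exprn_gt0 //; lra.
by move=> /le_trans; apply; lra.
Qed.

Variables (U : set V) (U_nbhs : open_nbhs (0 : V) U).
Variable (M : set V).
Hypothesis M_eq : M = [set p | U p /\ wcoord p = quadratic_part p + r (z_conj1 p)].

(** Conjugate the biholomorphism obtained for the small remainder by a dilation. *)
Theorem quadric_equiv : locally_biholo_equiv_at0 M (@quadric R n).
Proof.
have [e [K [s [e0 er s0 cK [s4 Ks]]]]] := scaled_small.
have c3' : no_terms_below (scaled_coef e) 3 by move=> a a3; rewrite /scaled_coef c3 // mulr0.
have [U' [W' [F' [G' [[U'o U'0] [W'o W'0] [F'd G'd F'P G'P] F'0 FP]]]]] :=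
  quadric_equiv_small n_ge2 s0 cK s4 Ks c3' (fun x => scaled_sums e0 er).
have en0 : e != 0 by rewrite gt_eqF.
have eVn0 : e^-1 != 0 by rewrite invr_eq0.
pose D := dil e^-1; pose E := dil e.
have DE p : D (E p) = p by exact: dilVK.
have ED p : E (D p) = p by exact: dilK.
have Dc p : {for p, continuous D} := differentiable_continuous (differentiable_dil _ _).
pose F p := E (F' (D p)); pose G p := E (G' (D p)).
have Fd p : U' (D p) -> differentiable F p.
  move=> U'p; apply: (differentiable_comp (f := F' \o D)); last exact: differentiable_dil.
  by apply: differentiable_comp; [exact: differentiable_dil|exact: F'd].
have Gd p : W' (D p) -> differentiable G p.
  move=> W'p; apply: (differentiable_comp (f := G' \o D)); last exact: differentiable_dil.
  by apply: differentiable_comp; [exact: differentiable_dil|exact: G'd].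
have [Uo U0] := U_nbhs.
have G'0 : G' 0 = 0 by rewrite -{1}F'0; have [] := F'P _ U'0.
have opennear (A : set V) p : open A -> A p -> \forall y \near p, A y.
  by move=> Ao Ap; apply: open_nbhs_nbhs.
have opennearD (A : set V) p : open A -> A (D p) -> \forall y \near p, A (D y).
  by move=> Ao Ap; apply: (Dc p); apply: opennear.
exists [set p | U p /\ U' (D p)], [set q | W' (D q) /\ U (G q)], F, G; split.
- split; last by rewrite /= /D dil0.
  rewrite openE => p [/= Up U'p]; apply: filterI; first exact: opennear.
  exact: opennearD.
- split; last by rewrite /= /G /D /E dil0 G'0 dil0.
  rewrite openE => q [/= Wq Uq]; apply: filterI; first exact: opennearD.
  by apply: (differentiable_continuous (Gd _ Wq)); apply: opennear.
- split.
  + by move=> p [_ U'p]; apply: Fd.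
  + by move=> q [W'q _]; apply: Gd.
  + move=> p [/= Up U'p]; have [W'F GF] := F'P _ U'p.
    by rewrite /F /G !DE GF ED.
  + move=> q [/= W'q Uq]; have [U'G FG] := G'P _ W'q.
    by rewrite /F /G !DE FG ED.
- by rewrite /F /D /E dil0 F'0 dil0.
move=> p [/= Up U'p]; have [Dp1 FE] := FP _ U'p.
apply: (iff_trans _ (iff_sym (quadric_dil (F' (D p)) en0))).
rewrite /quadric /= -[wcoord _]/(F' (D p) 0 ord_max) -FE M_eq /=.
have e20 : rc (e^-1 ^+ 2) != 0 by rewrite -rc0 (inj_eq (@rc_inj R)) expf_eq0.
rewrite /D quadratic_part_dil z_conj1_dil /scaled_sum scalerA -rcM divff // rc1 scale1r.
rewrite -mulrDr mxE eqxx.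
by split=> [[_ H]|/(mulfI e20) H]; [congr (_ * _)|split].
Qed.

End Scaling.

(** * Second order derivatives of a convergent power series *)

Section Jets.
Variables (R : realType) (m : nat).
Local Notation V := 'rV[C R]_m.
Implicit Types (f : V -> C R) (g : 'I_m -> V -> C R) (H : 'I_m -> V -> V -> C R).

(** f has gradient g on D, and each g_j has differential H_j, the Hessian being
    symmetric.  Symmetry is carried along as part of the data, since it holds for
    coordinates and is preserved by sums, products and limits. *)
Definition jet2 (D : set V) f g H : Prop := forall x, D x ->
  [/\ is_diff x f (fun h : V => \sum_j g j x * h 0 j),
      forall j, is_diff x (g j) (H j x) &
      forall h h' : V, \sum_j H j x h * h' 0 j = \sum_j H j x h' * h 0 j].

Lemma is_diff_eqfun (W : normedModType (C R)) (f : W -> C R) df df' x :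
  is_diff x f df -> df =1 df' -> is_diff x f df'.
Proof. by move=> fd /funext <-. Qed.

Lemma is_diffMfun (W : normedModType (C R)) (f f' df df' : W -> C R) x :
  is_diff x f df -> is_diff x f' df' ->
  is_diff x (fun y => f y * f' y) (fun h => f x * df' h + df h * f' x).
Proof.
move=> fd fd'; apply: (is_diff_eqfun (is_diffM fd fd')) => h.
by change (f x * df' h + f' x * df h = f x * df' h + df h * f' x); rewrite [f' x * _]mulrC.
Qed.

Lemma is_diffDfun (W : normedModType (C R)) (f f' df df' : W -> C R) x :
  is_diff x f df -> is_diff x f' df' ->
  is_diff x (fun y => f y + f' y) (fun h => df h + df' h).
Proof. by move=> fd fd'; exact: (is_diffD fd fd'). Qed.

Lemma jet2D D f g H f' g' H' : jet2 D f g H -> jet2 D f' g' H' ->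
  jet2 D (fun x => f x + f' x) (fun j x => g j x + g' j x) (fun j x h => H j x h + H' j x h).
Proof.
move=> fj fj' x Dx; have [fd gd sy] := fj x Dx; have [fd' gd' sy'] := fj' x Dx; split.
- apply: (is_diff_eqfun (is_diffDfun fd fd')) => h.
  by rewrite -big_split /=; apply: eq_bigr => j _; rewrite mulrDl.
- by move=> j; apply: is_diffDfun.
- move=> h h'; under eq_bigr do rewrite mulrDl; rewrite big_split /= sy sy' -big_split /=.
  by apply: eq_bigr => j _; rewrite mulrDl.
Qed.

Lemma jet2M D f g H f' g' H' : jet2 D f g H -> jet2 D f' g' H' ->
  jet2 D (fun x => f x * f' x) (fun j x => f x * g' j x + g j x * f' x)
    (fun j x h => f x * H' j x h + (\sum_l g l x * h 0 l) * g' j x +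
                  (g j x * (\sum_l g' l x * h 0 l) + H j x h * f' x)).
Proof.
move=> fj fj' x Dx; have [fd gd sy] := fj x Dx; have [fd' gd' sy'] := fj' x Dx; split.
- apply: (is_diff_eqfun (is_diffMfun fd fd')) => h.
  rewrite mulr_sumr mulr_suml -big_split /=; apply: eq_bigr => j _.
  by rewrite mulrDl mulrA; congr (_ + _); rewrite mulrAC.
- by move=> j; exact: (is_diffDfun (is_diffMfun fd (gd' j)) (is_diffMfun (gd j) fd')).
- have E (h h' : V) :
    \sum_j (f x * H' j x h + (\sum_l g l x * h 0 l) * g' j x +
                  (g j x * (\sum_l g' l x * h 0 l) + H j x h * f' x)) * h' 0 j =
    f x * (\sum_j H' j x h * h' 0 j) +
    (\sum_l g l x * h 0 l) * (\sum_j g' j x * h' 0 j) +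
    ((\sum_j g j x * h' 0 j) * (\sum_l g' l x * h 0 l) +
    (\sum_j H j x h * h' 0 j) * f' x).
    move: (\sum_l g l x * h 0 l) (\sum_l g' l x * h 0 l) => A A'.
    rewrite !mulr_sumr !mulr_suml -!big_split /=; apply: eq_bigr => j _.
    by ring.
  by move=> h h'; rewrite !E sy sy'; ring.
Qed.

Lemma jet2_cst D (a : C R) : jet2 D (fun=> a) (fun _ _ => 0) (fun _ _ _ => 0).
Proof.
move=> x _; split.
- apply: (is_diff_eqfun (is_diff_cst a x)) => h.
  by rewrite big1 // => j _; rewrite mul0r.
- by move=> j; apply: (is_diff_eqfun (is_diff_cst (0 : C R) x)).
- by move=> h h'; rewrite !big1 // => j _; rewrite mul0r.
Qed.

Lemma jet2_coord D i :
  jet2 D (fun x => x 0 i) (fun j _ => if j == i then 1 else 0) (fun _ _ _ => 0).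
Proof.
move=> x _; split.
- apply: (is_diff_eqfun (is_diff_coord x i)) => h.
  rewrite (bigD1 i) //= eqxx mul1r big1 ?addr0 // => j /negbTE ->.
  by rewrite mul0r.
- by move=> j; apply: (is_diff_eqfun (is_diff_cst _ x)).
- by move=> h h'; rewrite !big1 // => j _; rewrite mul0r.
Qed.

(** Bounds of homogeneous type for f and its gradient on the polydisc of radius X,
    with Y = 1 / X: values, Lipschitz constants, and the same for the gradient, where
    each differentiation costs a factor k / X. *)
Definition jet_bounds (X Y : R) (k : nat) f g : Prop := forall x y, nr x <= X -> nr y <= X ->
  [/\ nr (f x) <= X ^+ k, nr (f x - f y) <= k%:R * X ^+ k * Y * nr (x - y),
      forall j, nr (g j x) <= k%:R * X ^+ k * Y &
      forall j, nr (g j x - g j y) <= k%:R ^+ 2 * X ^+ k * Y ^+ 2 * nr (x - y)].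

Lemma jet_boundsM X Y k l f g f' g' : 0 <= X -> 0 <= Y -> jet_bounds X Y k f g -> jet_bounds X Y l f' g' ->
  jet_bounds X Y (k + l) (fun x => f x * f' x) (fun j x => f x * g' j x + g j x * f' x).
Proof.
move=> X0 Y0 B B' x y xX yX.
have [f1 f2 g1 g2] := B x y xX yX; have [f1' f2' g1' g2'] := B' x y xX yX.
have [f3 _ g3 _] := B y x yX xX; have [f3' _ g3' _] := B' y x yX xX.
have Xk := exprn_ge0 k X0; have Xl := exprn_ge0 l X0.
have d0 := nr_ge0 (x - y).
have b1 : 0 <= k%:R * X ^+ k * Y by rewrite !mulr_ge0.
have b2 : 0 <= l%:R * X ^+ l * Y by rewrite !mulr_ge0.
have prodle (u v : C R) a b : nr u <= a -> nr v <= b -> nr (u * v) <= a * b.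
  by move=> ua vb; rewrite nrM ler_pM ?nr_ge0.
split.
- by rewrite exprD; apply: prodle.
- have -> : f x * f' x - f y * f' y = f x * (f' x - f' y) + (f x - f y) * f' y by ring.
  apply: le_trans (nrD _ _) _; apply: le_trans (lerD (prodle _ _ _ _ f1 f2') (prodle _ _ _ _ f2 f3')) _.
  by rewrite natrD exprD le_eqVlt; apply/orP; left; apply/eqP; ring.
- move=> j; apply: le_trans (nrD _ _) _.
  apply: le_trans (lerD (prodle _ _ _ _ f1 (g1' j)) (prodle _ _ _ _ (g1 j) f1')) _.
  by rewrite natrD exprD le_eqVlt; apply/orP; left; apply/eqP; ring.
- move=> j.
  have -> : f x * g' j x + g j x * f' x - (f y * g' j y + g j y * f' y) =
     (f x * (g' j x - g' j y) + (f x - f y) * g' j y) +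
     (g j x * (f' x - f' y) + (g j x - g j y) * f' y) by ring.
  apply: le_trans (nrD _ _) _; apply: le_trans (lerD (nrD _ _) (nrD _ _)) _.
  apply: le_trans (lerD (lerD (prodle _ _ _ _ f1 (g2' j)) (prodle _ _ _ _ f2 (g3' j)))
     (lerD (prodle _ _ _ _ (g1 j) f2') (prodle _ _ _ _ (g2 j) f3'))) _.
  by rewrite natrD exprD le_eqVlt; apply/orP; left; apply/eqP; ring.
Qed.

Lemma jet_bounds1 X Y : jet_bounds X Y 0 (fun=> 1) (fun _ _ => 0).
Proof.
move=> x y _ _; split; rewrite ?expr0 ?nr1 // ?subrr ?nr0 ?mul0r //.
by move=> _; rewrite expr2 !mul0r.
Qed.

Lemma jet_bounds_coord X Y i : X * Y = 1 ->
  jet_bounds X Y 1 (fun x => x 0 i) (fun j _ => if j == i then 1 else 0).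
Proof.
move=> XY x y xX yX; rewrite mul1r expr1 XY mul1r; split.
- exact: le_trans (nr_coord x i) xX.
- by have := nr_coord (x - y) i; rewrite !mxE.
- by move=> j; case: ifP => _; rewrite ?nr1 ?nr0.
- move=> j; rewrite subrr nr0 expr1n mul1r expr2 mulrA XY mul1r.
  by rewrite mulr_ge0 ?nr_ge0 //; have := le_trans (nr_ge0 _) xX; nra.
Qed.

(** A function homogeneous of degree k; the radius X is left free, as it must be
    adapted to the point at which the series is differentiated. *)
Definition graded_jet (k : nat) f : Prop := exists g H, jet2 setT f g H /\
  forall X Y, 0 <= X -> 0 <= Y -> X * Y = 1 -> jet_bounds X Y k f g.

Lemma graded_jetM k l f f' : graded_jet k f -> graded_jet l f' -> graded_jet (k + l) (fun x => f x * f' x).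
Proof.
move=> [g [H [J B]]] [g' [H' [J' B']]]; do 2 eexists; split; first exact: (jet2M J J').
by move=> X Y X0 Y0 XY; apply: jet_boundsM => //; [apply: B|apply: B'].
Qed.

Lemma graded_jet1 : graded_jet 0 (fun=> 1).
Proof. by do 2 eexists; split=> [|X Y _ _ _]; [exact: jet2_cst|exact: jet_bounds1]. Qed.

Lemma graded_jet_coord i : graded_jet 1 (fun x => x 0 i).
Proof. by do 2 eexists; split=> [|X Y _ _ XY]; [exact: jet2_coord|exact: jet_bounds_coord]. Qed.

Lemma graded_jet_monom a : graded_jet (deg a) (monom a).
Proof.
have gX i k : graded_jet k (fun x : V => x 0 i ^+ k).
  elim: k => [|k IH]; first exact: graded_jet1.
  have -> : (fun x : V => x 0 i ^+ k.+1) = (fun x => x 0 i * x 0 i ^+ k).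
    by apply/funext => x; rewrite exprS.
  exact: (graded_jetM (graded_jet_coord i) IH).
rewrite /deg /monom; elim: (index_enum _) => [|i s IH].
  have -> : (fun x : V => \prod_(i <- [::]) x 0 i ^+ a i) = fun=> 1.
    by apply/funext => x; rewrite big_nil.
  rewrite big_nil; exact: graded_jet1.
have -> : (fun x : V => \prod_(i <- i :: s) x 0 i ^+ a i) =
    (fun x => x 0 i ^+ a i * \prod_(i <- s) x 0 i ^+ a i).
  by apply/funext => x; rewrite big_cons.
by rewrite big_cons; apply: graded_jetM.
Qed.

(** Used with d fixed: the factors k produced by differentiation are absorbed by an
    arbitrarily slow geometric growth. *)
Lemma bernoulli (d : R) k : 0 <= d -> k%:R * d <= (1 + d) ^+ k.
Proof.
move=> d0; suff : 1 + k%:R * d <= (1 + d) ^+ k by apply: le_trans; rewrite lerDr.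
elim: k => [|k IH]; first by rewrite mul0r addr0 expr0.
rewrite exprS; have k0 : 0 <= k%:R :> R by [].
have : (1 + d) * (1 + k%:R * d) <= (1 + d) * (1 + d) ^+ k by rewrite ler_wpM2l // addr_ge0.
apply: le_trans; rewrite -natr1; nra.
Qed.

Variables (c : {ffun 'I_m -> nat} -> C R) (rho : R) (r : V -> C R).
Hypothesis cr : is_pseries_sum c rho r.

(** Around x choose a radius X between |x| and rho, then a slightly larger radius
    X2 = q^2 X < rho; the factors k and k^2 of the Lipschitz constants of the monomials
    and of their gradients on the polydisc of radius X are absorbed by q^(2 k).  Both
    the series and the series of its gradient can then be differentiated termwise, and
    the symmetry of the Hessian passes to the limit. *)
Lemma pseries_jet2 : exists g H,
  jet2 [set x | nr x < rho] (fun x => gsum c (fun a => monom a x)) g H.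
Proof.
have [rho0 _ _] := is_pseries_sumE cr.
have [K K0 cK] := cnorm_geo cr.
have /boolp.choice [g gP] := graded_jet_monom.
have /boolp.choice [H HP] := gP.
exists (fun j x => gsum c (fun a => g a j x)).
exists (fun j x h => 'd (fun y => gsum c (fun a => g a j y)) x h) => x /= xr.
have JM a : jet2 setT (monom a) (g a) (H a) := (HP a).1.
have BM a := (HP a).2.
pose X := (nr x + rho) / 2.
have x0 := nr_ge0 x.
have xX : nr x < X by rewrite /X; lra.
have X0 : 0 < X by rewrite /X; lra.
have Xr : X < rho by rewrite /X; lra.
(* q = 1 + d satisfies q^2 X < rho, since d <= 1/4. *)
pose d := (rho - X) / (4 * rho).
have d0 : 0 < d by rewrite divr_gt0 ?subr_gt0 ?mulr_gt0.
have dE : d * (4 * rho) = rho - X by rewrite /d divfK // gt_eqF // mulr_gt0.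
have d1 : d <= 4^-1 by nra.
pose q := 1 + d.
pose X2 := q ^+ 2 * X.
have q0 : 1 <= q by rewrite lerDl ltW.
have X20 : 0 < X2 by rewrite mulr_gt0 // exprn_gt0 // (lt_le_trans ltr01).
have X2r : X2 < rho by rewrite /X2 /q; nra.
have sX : rho^-1 * X2 < 1 by rewrite mulrC ltr_pdivrMr // mul1r.
pose Y := X^-1.
have Y0 : 0 <= Y by rewrite invr_ge0 ltW.
have XY : X * Y = 1 by rewrite /Y divff // gt_eqF.
pose B := (1 + d^-1) ^+ 2 * (1 + Y) ^+ 2.
have dV0 : 0 <= d^-1 by rewrite invr_ge0 ltW.
have kq k : k%:R <= d^-1 * q ^+ k.
  by rewrite ler_pdivlMl // mulrC bernoulli // ltW.
have qk k : 1 <= q ^+ k by rewrite exprn_ege1.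
have Xk k := exprn_ge0 k (ltW X0).
have X2E k : X2 ^+ k = q ^+ k * q ^+ k * X ^+ k by rewrite /X2 exprMn exprAC expr2.
have BE k : B * X2 ^+ k = ((1 + d^-1) * q ^+ k * (1 + Y)) ^+ 2 * X ^+ k.
  by rewrite X2E /B; ring.
have Z1 k : 1 <= (1 + d^-1) * q ^+ k * (1 + Y).
  by rewrite mulr_ege1 ?mulr_ege1 ?lerDl.
have Zk k : k%:R * Y <= (1 + d^-1) * q ^+ k * (1 + Y).
  apply: ler_pM; rewrite ?lerDr //; apply: le_trans (kq k) _.
  by rewrite ler_wpM2r ?lerDr // (le_trans ler01).
have B0 k : X ^+ k <= B * X2 ^+ k.
  by rewrite BE -[leLHS]mul1r ler_wpM2r // exprn_ege1.
have B1 k : k%:R * X ^+ k * Y <= B * X2 ^+ k.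
  rewrite BE mulrAC ler_wpM2r // (le_trans (Zk k)) // expr2 -[leLHS]mul1r.
  by rewrite ler_wpM2r // (le_trans ler01).
have B2 k : k%:R ^+ 2 * X ^+ k * Y ^+ 2 <= B * X2 ^+ k.
  rewrite BE mulrAC -exprMn ler_wpM2r //; apply: lerXn2r (Zk k); rewrite nnegrE.
    by rewrite mulr_ge0.
  exact: le_trans ler01 (Z1 k).
have rV0 : 0 <= rho^-1 by rewrite invr_ge0 ltW.
have nearX : \forall y \near x, nr y <= X.
  apply/near_nr; exists (X - nr x); first by rewrite subr_gt0.
  by move=> y; have := nrD (y - x) x; rewrite subrK; lra.
have [fd fS] : differentiable (fun y => gsum c (fun a => monom a y)) x /\
  forall h, sums (hsum c (fun a => 'd (monom a) x h))
     ('d (fun y => gsum c (fun a => monom a y)) x h).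
  apply: (gsum_diff (e := fun a => monom a) (B := B) (X := X2) rV0 cK (ltW X20) sX).
  - by move=> a; have [fd _ _] := JM a x I; exact: (ex_diff (is_diff_def := fd)).
  - apply: filterS nearX => y yX a; have [H1 _ _ _] := BM a _ _ (ltW X0) Y0 XY y x yX (ltW xX).
    exact: le_trans H1 (B0 _).
  - apply: filterS nearX => y yX a; have [_ H1 _ _] := BM a _ _ (ltW X0) Y0 XY y x yX (ltW xX).
    apply: le_trans H1 _; rewrite [leRHS]mulrAC ler_wpM2r ?nr_ge0 //.
have gd j : differentiable (fun y => gsum c (fun a => g a j y)) x /\
  forall h, sums (hsum c (fun a => 'd (g a j) x h))
     ('d (fun y => gsum c (fun a => g a j y)) x h).
  apply: (gsum_diff (e := fun a => g a j) (B := B) (X := X2) rV0 cK (ltW X20) sX).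
  - by move=> a; have [_ gd _] := JM a x I; exact: (ex_diff (is_diff_def := gd j)).
  - apply: filterS nearX => y yX a; have [_ _ H1 _] := BM a _ _ (ltW X0) Y0 XY y x yX (ltW xX).
    exact: le_trans (H1 j) (B1 _).
  - apply: filterS nearX => y yX a; have [_ _ _ H1] := BM a _ _ (ltW X0) Y0 XY y x yX (ltW xX).
    apply: le_trans (H1 j) _; rewrite [leRHS]mulrAC ler_wpM2r ?nr_ge0 //.
have gS j : sums (hsum c (fun a => g a j x)) (gsum c (fun a => g a j x)).
  apply: (gsumP rV0 cK (X := X2) (B := B) (ltW X20) sX) => a.
  have [_ _ H1 _] := BM a _ _ (ltW X0) Y0 XY x x (ltW xX) (ltW xX).
  exact: le_trans (H1 j) (B1 _).
split.
- have fdP := differentiableP fd.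
  apply: (is_diff_eqfun fdP) => h; apply: (sums_uniq (fS h)).
  have -> : (fun a => 'd (monom a) x h : C R) = (fun a => \sum_j h 0 j * g a j x).
    apply/funext => a; have [fda _ _] := JM a x I.
    rewrite (congr1 (fun u : V -> C R => u h) (diff_val (is_diff_def := fda))).
    by apply: eq_bigr => j _; rewrite mulrC.
  have := gsum_sum (r := index_enum 'I_m) (u := fun j => h 0 j) gS.
  by under [X in sums _ X]eq_bigr do rewrite mulrC.
- by move=> j; apply: differentiableP; exact: (gd j).1.
- move=> h h'.
  have S (u u' : V) : sums (hsum c (fun a => \sum_j u' 0 j * 'd (g a j) x u))
      (\sum_j u' 0 j * 'd (fun y => gsum c (fun a => g a j y)) x u).
    exact: (gsum_sum (r := index_enum 'I_m) (u := fun j => u' 0 j) (fun j => (gd j).2 u)).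
  under eq_bigr do rewrite mulrC; under [RHS]eq_bigr do rewrite mulrC.
  apply: (sums_uniq (S h h')).
  have -> : (fun a => \sum_j h' 0 j * 'd (g a j) x h : C R) =
            (fun a => \sum_j h 0 j * 'd (g a j) x h').
    apply/funext => a; have [_ gda sy] := JM a x I.
    have E u j : 'd (g a j) x u = H a j x u.
      exact: (congr1 (fun w : V -> C R => w u) (diff_val (is_diff_def := gda j))).
    under eq_bigr do rewrite E mulrC; under [RHS]eq_bigr do rewrite E mulrC.
    exact: sy.
  exact: S.
Qed.

End Jets.

(** * Curves with a real parameter in complex normed spaces *)

Section RealCurves.
Variables (R : realType).

Lemma near0_real (P : set R) :
  (\forall t \near (0 : R), P t) <-> exists2 d : R, 0 < d & forall t, `|t| < d -> P t.
Proof.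
split=> [/nbhs_normP [d /= d0 dP]|[d d0 dP]].
  by exists d => // t td; apply: dP; rewrite /= sub0r normrN.
by apply/nbhs_normP; exists d => //= t /=; rewrite sub0r normrN; apply: dP.
Qed.

Lemma is_derive0P (W : normedModType R) (gamma : R -> W) (v : W) :
  is_derive (0 : R) (1 : R) gamma v <->
  forall e : R, 0 < e -> \forall t \near (0 : R), `|gamma t - gamma 0 - t *: v| <= e * `|t|.
Proof.
split=> [[gd gE] e e0|gv].
  have /eqaddoP /(_ e e0) := derivable_nbhs gd; rewrite gE.
  apply: filterS => t; rewrite !fctE /= addr0 opprD addrA.
  by rewrite [t *: 1]mulr1.
have cv : (fun h => h^-1 *: ((gamma \o shift 0) (h *: 1) - gamma 0)) @ 0^' --> v.
  apply/cvgrPdist_le => e e0.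
  have := gv e e0; rewrite near_withinE; apply: filterS => t H t0.
  rewrite /= addr0 [t *: 1]mulr1 distrC.
  have -> : t^-1 *: (gamma t - gamma 0) - v = t^-1 *: (gamma t - gamma 0 - t *: v).
    by rewrite [RHS]scalerBr scalerA mulVf // scale1r.
  by rewrite normrZ normfV ler_pdivrMl ?normr_gt0 // mulrC.
by apply: DeriveDef; [exact: (cvgP _ cv)|exact: (cvg_lim _ cv)].
Qed.

Implicit Types (V W : normedModType (C R)).

(** v is the derivative at 0 of the curve u in a complex normed space.  The
    parameter is real, while the scalars of the space are complex. *)
Definition cder V (u : R -> V) (v : V) : Prop :=
  forall e : R, 0 < e -> \forall t \near (0 : R), nr (u t - u 0 - rc t *: v) <= e * `|t|.

Lemma cder_lip V (u : R -> V) (v : V) : cder u v ->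
  \forall t \near (0 : R), nr (u t - u 0) <= (nr v + 1) * `|t|.
Proof.
move=> uv; apply: filterS (uv 1 ltr01) => t H.
have := nrD (u t - u 0 - rc t *: v) (rc t *: v); rewrite subrK nrZ nr_rc; lra.
Qed.

Lemma cder_cont V (u : R -> V) (v : V) e : cder u v -> 0 < e ->
  \forall t \near (0 : R), nr (u t - u 0) < e.
Proof.
move=> /cder_lip /near0_real [d d0 dP] e0; apply/near0_real.
have K0 : 0 < nr v + 1 by rewrite ltr_wpDl ?nr_ge0.
exists (Order.min d (e / (nr v + 1))) => [|t]; first by rewrite lt_min d0 divr_gt0.
rewrite lt_min => /andP[/dP H]; rewrite ltr_pdivlMr // mulrC; exact: le_lt_trans.
Qed.

Lemma cder_nbhs V (u : R -> V) (v : V) (P : set V) : cder u v ->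
  (\forall y \near u 0, P y) -> \forall t \near (0 : R), P (u t).
Proof.
move=> uv /near_nr [d d0 dP]; apply: filterS (cder_cont uv d0) => t; exact: dP.
Qed.

Lemma cder_uniq V (u u' : R -> V) v v' : cder u v -> cder u' v' ->
  (\forall t \near (0 : R), u t = u' t) -> v = v'.
Proof.
move=> uv uv' uu'; apply/eqP; rewrite -subr_eq0; apply/eqP/nr_eq0/eqP.
rewrite eq_le nr_ge0 andbT; apply/ler_addgt0Pr => e e0; rewrite add0r.
have e2 : 0 < e / 2 by rewrite divr_gt0.
have u0 := nbhs_singleton uu'.
have /near0_real [d d0 dP] : \forall t \near (0 : R),
    nr (u t - u 0 - rc t *: v) <= e / 2 * `|t| /\
    (nr (u' t - u' 0 - rc t *: v') <= e / 2 * `|t| /\ u t = u' t).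
  exact: (filterI (uv _ e2) (filterI (uv' _ e2) uu')).
have := dP (d / 2); rewrite gtr0_norm ?divr_gt0 //.
have -> : d / 2 < d by lra.
have d20 : 0 < d / 2 by rewrite divr_gt0.
move=> /(_ isT) [H1 [H2 H3]]; rewrite H3 u0 in H1.
have := nrB (u' (d / 2) - u' 0 - rc (d / 2) *: v') (u' (d / 2) - u' 0 - rc (d / 2) *: v).
rewrite opprB addrC addrA subrK -scalerBr nrZ nr_rc gtr0_norm // => H.
by rewrite -(ler_pM2l d20); lra.
Qed.

Lemma cder_pair V W (u : R -> V) v (w : R -> W) v' : cder u v -> cder w v' ->
  cder (fun t => (u t, w t)) (v, v').
Proof.
move=> uv wv e e0; apply: filterS2 (uv e e0) (wv e e0) => t H1 H2.
by rewrite nr_pair /= ge_max H1 H2.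
Qed.

Lemma cder_comp V W (u : R -> V) v (f : V -> W) df : cder u v -> is_diff (u 0) f df ->
  cder (fun t => f (u t)) (df v).
Proof.
move=> uv fd e e0.
have fdiff : differentiable f (u 0) := ex_diff (is_diff_def := fd).
have fE : 'd f (u 0) = df :> (V -> W) := diff_val (is_diff_def := fd).
have [K K0 KP] := diff_boundedP fdiff.
have c0 : 0 < nr v + 1 by rewrite ltr_wpDl ?nr_ge0.
have e1 : 0 < e / 2 / (nr v + 1) by rewrite !divr_gt0.
have e2 : 0 < e / 2 / K by rewrite !divr_gt0.
apply: filterS3 (cder_nbhs uv (diff_epsP fdiff e1)) (cder_lip uv) (uv _ e2) => t H1 H2 H3.
pose D : {linear V -> W} := 'd f (u 0).
have -> : f (u t) - f (u 0) - rc t *: df v =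
    (f (u t) - f (u 0) - D (u t - u 0)) + D (u t - u 0 - rc t *: v).
  have -> : df v = D v := esym (congr1 (fun g : V -> W => g v) fE).
  have -> : D (u t - u 0 - rc t *: v) = D (u t - u 0) - D (rc t *: v) := linearB D _ _.
  have -> : D (rc t *: v) = rc t *: D v := linearZZ D _ _.
  by rewrite addrA subrK.
apply: le_trans (nrD _ _) _.
rewrite [leRHS](_ : _ = e / 2 * `|t| + e / 2 * `|t|); last by field.
apply: lerD.
  apply: le_trans H1 _.
  apply: (@le_trans _ _ (e / 2 / (nr v + 1) * ((nr v + 1) * `|t|))).
    by rewrite ler_wpM2l // ltW.
  by rewrite mulrA divfK // gt_eqF.
apply: le_trans (KP _) _.
apply: (@le_trans _ _ (K * (e / 2 / K * `|t|))); first by rewrite ler_wpM2l // ltW.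
by rewrite mulrA [K * _]mulrC divfK // gt_eqF.
Qed.

(** For maps that are R-linear but not C-linear, such as (z, w) |-> (z, conj z_1).
    The hypothesis groups additivity and real homogeneity in the single combination
    that occurs in the difference quotient. *)
Lemma cder_rlin V W (L : V -> W) (K : R) (u : R -> V) v :
  (forall a b t c, L (a - b - rc t *: c) = L a - L b - rc t *: L c) ->
  (forall a, nr (L a) <= K * nr a) -> cder u v -> cder (fun t => L (u t)) (L v).
Proof.
move=> Llin LK uv e e0.
have K1 : 0 < `|K| + 1 by rewrite ltr_wpDl.
have e1 : 0 < e / (`|K| + 1) by rewrite divr_gt0.
apply: filterS (uv _ e1) => t H; rewrite -Llin; apply: le_trans (LK _) _.
apply: (@le_trans _ _ ((`|K| + 1) * nr (u t - u 0 - rc t *: v))).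
  by rewrite ler_wpM2r ?nr_ge0 // (le_trans (ler_norm K)) // lerDl.
apply: (@le_trans _ _ ((`|K| + 1) * (e / (`|K| + 1) * `|t|))); first by rewrite ler_wpM2l // ltW.
by rewrite mulrA [(_ + 1) * _]mulrC divfK // gt_eqF.
Qed.

Lemma cder_cst V (a : V) : cder (fun=> a) 0.
Proof.
move=> e e0; apply/near0_real; exists 1 => // t _.
by rewrite subrr scaler0 subr0 nr0 mulr_ge0 // ltW.
Qed.

Section Unreal.
Variable m : nat.
Implicit Types (p q : 'rV[C R]_m) (v w : 'rV[R]_(m + m)).

Definition unreal v : 'rV[C R]_m :=
  \row_j cplx (v 0 (lshift m j)) (v 0 (rshift m j)).

Lemma re_unreal v j : re (unreal v 0 j) = v 0 (lshift m j).
Proof. by rewrite mxE re_cplx. Qed.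

Lemma im_unreal v j : im (unreal v 0 j) = v 0 (rshift m j).
Proof. by rewrite mxE im_cplx. Qed.

Lemma realifyK p : unreal (realify p) = p.
Proof. by apply/rowP => j; rewrite mxE realify_re realify_im cplxE. Qed.

Lemma unrealK v : realify (unreal v) = v.
Proof.
apply/rowP => i; case: (split_ordP i) => j ->.
  by rewrite realify_re re_unreal.
by rewrite realify_im im_unreal.
Qed.

Lemma complex_ext (x y : C R) : re x = re y -> im x = im y -> x = y.
Proof. by move=> H1 H2; rewrite -[x]cplxE -[y]cplxE H1 H2. Qed.

Lemma unreal_lin v w t u : unreal (v - w - t *: u) = unreal v - unreal w - rc t *: unreal u.
Proof.
apply/rowP => j; apply: complex_ext.
  by rewrite re_unreal !mxE !reD !reN re_rcM !re_cplx.
by rewrite im_unreal !mxE !imD !imN im_rcM !im_cplx.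
Qed.

Lemma unrealB v w : unreal (v - w) = unreal v - unreal w.
Proof.
apply/rowP => j; apply: complex_ext.
  by rewrite re_unreal !mxE reD reN !re_cplx.
by rewrite im_unreal !mxE imD imN !im_cplx.
Qed.

Lemma realify_lin p q t u : realify (p - q - rc t *: u) = realify p - realify q - t *: realify u.
Proof. by rewrite -[RHS]unrealK unreal_lin !realifyK. Qed.

Lemma norm_coord k (v : 'rV[R]_k) i : `|v 0 i| <= `|v|.
Proof.
by rewrite [leRHS]/Num.Def.normr /= mx_normrE; apply: (le_bigmax _ (fun j => `|v j.1 j.2|) (0, i)).
Qed.

Lemma norm_rV_le k (v : 'rV[R]_k) e : 0 <= e -> (forall i, `|v 0 i| <= e) -> `|v| <= e.
Proof.
move=> e0 ve; rewrite [leLHS]/Num.Def.normr /= mx_normrE.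
by apply: bigmax_le => // -[j i] _; rewrite ord1.
Qed.

Lemma nr_unreal v : nr (unreal v) <= 2 * `|v|.
Proof.
apply: nr_rV_le => [|j]; first by rewrite mulr_ge0.
apply: le_trans (nr_le_ReIm _) _; rewrite re_unreal im_unreal.
have := norm_coord v (lshift m j); have := norm_coord v (rshift m j); lra.
Qed.

Lemma norm_realify p : `|realify p| <= nr p.
Proof.
apply: norm_rV_le => [|i]; first exact: nr_ge0.
case: (split_ordP i) => j ->.
  by rewrite realify_re; apply: le_trans (Re_le_nr _) (nr_coord p j).
by rewrite realify_im; apply: le_trans (Im_le_nr _) (nr_coord p j).
Qed.

Lemma is_derive_cder (gamma : R -> 'rV[R]_(m + m)) v :
  is_derive (0 : R) (1 : R) gamma v -> cder (fun t => unreal (gamma t)) (unreal v).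
Proof.
move=> /is_derive0P gv e e0; have e2 : 0 < e / 2 by rewrite divr_gt0.
apply: filterS (gv _ e2) => t H; rewrite -unreal_lin.
by apply: le_trans (nr_unreal _) _; lra.
Qed.

Lemma cder_is_derive (u : R -> 'rV[C R]_m) p : cder u p ->
  is_derive (0 : R) (1 : R) (fun t => realify (u t)) (realify p).
Proof.
move=> up; apply/is_derive0P => e e0; apply: filterS (up _ e0) => t H.
by rewrite -realify_lin; apply: le_trans (norm_realify _) H.
Qed.

Lemma unreal_J v : unreal (Jmap v) = cplx 0 1 *: unreal v.
Proof.
apply/rowP => j; rewrite [LHS]mxE [RHS]mxE [unreal v 0 j]mxE cplx_iM /Jmap row_mxEl row_mxEr !mxE.
by congr (cplx (- _) _).
Qed.

End Unreal.
End RealCurves.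

(** * Levi-flatness of graphs over (z, conj z_1) *)

Section LeviFlat.
Variables (R : realType) (n : nat) (n_ge2 : (2 <= n)%N).
Local Notation V := 'rV[C R]_n.+1.
Local Notation VR := 'rV[R]_(n.+1 + n.+1).
Implicit Types (p q v : V) (x h : V).
Local Notation kap := (@z_conj1 R n).
Local Notation ii := (cplx (0 : R) 1).

Let i0 : 'I_n.+1 := inord 0.

Lemma kap_lin p q (t : R) v : kap (p - q - rc t *: v) = kap p - kap q - rc t *: kap v.
Proof.
apply/rowP => i; rewrite z_conj1E !mxE.
have [_|_] := eqVneq i ord_max => //.
by rewrite !cjD !cjN cjM cj_rc.
Qed.

Lemma kapB p q : kap (p - q) = kap p - kap q.
Proof. by have := kap_lin p q 0 0; rewrite rc0 !scale0r !subr0. Qed.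

Lemma nr_kap p : nr (kap p) <= 1 * nr p.
Proof.
rewrite mul1r; apply: nr_rV_le => [|i]; first exact: nr_ge0.
by rewrite z_conj1E; case: ifP => _; rewrite ?nr_conj nr_coord.
Qed.

Lemma kap_ext p q : (forall i, i != ord_max -> p 0 i = q 0 i) -> kap p = kap q.
Proof.
move=> pq; apply/rowP => i; rewrite !z_conj1E.
case: (boolP (i == ord_max)) => [_|/pq //].
by rewrite pq // (i0_max n_ge2).
Qed.

Lemma cder_kap (u : R -> V) v : cder u v -> cder (fun t => kap (u t)) (kap v).
Proof. exact: (cder_rlin kap_lin nr_kap). Qed.

Lemma cder_coord (u : R -> V) v i : cder u v -> cder (fun t => u t 0 i : C R) (v 0 i).
Proof. by move=> uv; apply: (cder_comp uv (is_diff_coord _ i)). Qed.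

Variables (Phi : V -> C R) (g : 'I_n.+1 -> V -> C R) (H : 'I_n.+1 -> V -> V -> C R).
Variables (D : set V) (J : jet2 D Phi g H).
Variables (U : set V) (U_open : open U) (UD : forall p, U p -> D (kap p)).

Definition conj_graph : set V := [set p | U p /\ p 0 ord_max = Phi (kap p)].

(** The tangency condition v_w = dPhi(kap v), where kap v is the image of v under the
    R-linear map kap, and the differential of Phi is taken at kap p. *)
Definition graph_tangent p v : Prop := v 0 ord_max = \sum_j g j (kap p) * kap v 0 j.

Lemma tangent_graph p (v : VR) : conj_graph p ->
  tangent (@realify R n.+1 @` conj_graph) (realify p) v -> graph_tangent p (unreal v).
Proof.
move=> [Up pE] [gamma [g0 gM gv]].
have uv := is_derive_cder gv.
have u0 : unreal (gamma 0) = p by rewrite g0 realifyK.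
have [Pd _ _] := J (UD Up).
have Pd' : is_diff (kap (unreal (gamma 0))) Phi (fun h => \sum_j g j (kap p) * h 0 j) by rewrite u0.
have c1 := cder_comp (cder_kap uv) Pd'.
have c2 := cder_coord ord_max uv.
apply: (cder_uniq c2 c1); apply: filterS gM => t [q [Uq qE] <-].
by rewrite realifyK.
Qed.

(** Correct the w component of the line p + t v so that it stays on the graph; the
    condition on v says that the correction is of second order. *)
Lemma graph_tangent_tangent p v : conj_graph p -> graph_tangent p v ->
  tangent (@realify R n.+1 @` conj_graph) (realify p) (realify v).
Proof.
move=> [Up pE] Tv.
pose l t : V := p + rc t *: v.
have l0 : l 0 = p by rewrite /l rc0 scale0r addr0.
have lv : cder l v.
  move=> e e0; apply/near0_real; exists 1 => // t _.
  by rewrite l0 /l [p + _]addrC addrK subrr nr0 mulr_ge0 // ltW.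
have [Pd _ _] := J (UD Up).
have Pd' : is_diff (kap (l 0)) Phi (fun h => \sum_j g j (kap p) * h 0 j) by rewrite l0.
have Pl := cder_comp (cder_kap lv) Pd'.
(* The point of the graph above the z component of the line. *)
pose u t : V := \row_i (if i == ord_max then Phi (kap (l t)) else l t 0 i).
have kapu t : kap (u t) = kap (l t).
  by apply: kap_ext => i ni; rewrite mxE (negbTE ni).
have u0 : u 0 = p.
  apply/rowP => i; rewrite mxE l0; case: (eqVneq i ord_max) => // ->.
  by rewrite pE.
have uv : cder u v.
  move=> e e0.
  have c1 := Pl e e0; have c2 := lv e e0.
  apply: filterS2 c1 c2 => t H1 H2.
  have e0' : 0 <= e * `|t| by rewrite mulr_ge0 // ltW.
  apply: nr_rV_le => // i; rewrite !mxE.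
  case: (eqVneq i ord_max) => [->|ni]; first by rewrite [v 0 ord_max]Tv.
  by have := nr_coord (l t - l 0 - rc t *: v) i; rewrite !mxE => /le_trans; apply.
exists (fun t => realify (u t)); split.
- by rewrite u0.
- have Un : \forall y \near u 0, U y by rewrite u0; apply: near_open.
  apply: filterS (cder_nbhs uv Un) => t Ut; exists (u t) => //; split=> //.
  by rewrite kapu mxE eqxx.
- exact: cder_is_derive.
Qed.

Lemma kap_i v : kap (ii *: v) 0 ord_max = - ii * kap v 0 ord_max.
Proof. by rewrite !z_conj1E eqxx mxE cjM cj_i. Qed.

Lemma kap_i_other v i : i != ord_max -> kap (ii *: v) 0 i = ii * kap v 0 i.
Proof. by move=> /negbTE ni; rewrite !z_conj1E ni mxE. Qed.

(** dPhi(kap v) is C-linear in v up to the term in conj v_1, for which kap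
    anticommutes with i; hence twice this term appears. *)
Lemma sum_kap_i p v : \sum_j g j (kap p) * kap (ii *: v) 0 j =
  ii * (\sum_j g j (kap p) * kap v 0 j) - 2 * (ii * (g ord_max (kap p) * kap v 0 ord_max)).
Proof.
rewrite (bigD1 ord_max) //= [in RHS](bigD1 ord_max) //= kap_i.
under eq_bigr => j nj do rewrite kap_i_other // mulrCA.
by rewrite -mulr_sumr; ring.
Qed.

Lemma ii_neq0 : ii != 0.
Proof.
by apply/eqP => i0'; have := cplx_i_sqr R; rewrite i0' mul0r => /eqP; rewrite eq_sym oppr_eq0 oner_eq0.
Qed.

(** If both v and - i v satisfy the tangency condition, then by sum_kap_i
    twice the term in conj v_1 vanishes, and conversely. *)
Lemma complex_tangent_graphP p v : conj_graph p ->
  complex_tangent (@realify R n.+1 @` conj_graph) (realify p) (realify v) <->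
  graph_tangent p v /\ g ord_max (kap p) * kap v 0 ord_max = 0.
Proof.
move=> Mp; split.
- move=> [/(tangent_graph Mp)]; rewrite realifyK => Tv [w /(tangent_graph Mp) Tw wE].
  split=> //.
  have vE : v = ii *: unreal w by rewrite -unreal_J wE realifyK.
  move: Tv; rewrite /graph_tangent {1}vE mxE Tw vE sum_kap_i kap_i => /eqP.
  rewrite -subr_eq0 opprB addrCA subrr addr0 !mulf_eq0 (negbTE ii_neq0) pnatr_eq0 /= => gk.
  by apply/eqP; rewrite mulrCA mulf_eq0 oppr_eq0 (negbTE ii_neq0) /= mulf_eq0.
- move=> [Tv gk]; split; first exact: graph_tangent_tangent.
  (* v = i (- i v), and - i v is tangent as well. *)
  exists (realify (- ii *: v)); last first.
    rewrite -[LHS]unrealK unreal_J realifyK scalerA mulrN cplx_i_sqr opprK.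
    by rewrite scale1r.
  apply: graph_tangent_tangent => //.
  have E : ii *: (- ii *: v) = v by rewrite scalerA mulrN cplx_i_sqr opprK scale1r.
  have kE : kap v 0 ord_max = - ii * kap (- ii *: v) 0 ord_max by rewrite -kap_i E.
  have gk' : g ord_max (kap p) * kap (- ii *: v) 0 ord_max = 0.
    move: gk => /eqP; rewrite kE mulrCA mulf_eq0 oppr_eq0 (negbTE ii_neq0) /= => /eqP //.
  move: (Tv); rewrite /graph_tangent -{1 2}E sum_kap_i gk' !mulr0 subr0 mxE => /(mulfI ii_neq0) //.
Qed.

Lemma is_diff_gradient x y :
  D x -> is_diff (x, y) (fun w : V * V => \sum_j g j w.1 * w.2 0 j)
    (fun w => \sum_j (g j x * w.2 0 j + H j x w.1 * y 0 j)).
Proof.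
move=> Dx; have [_ gd _] := J Dx.
have f1 j : is_diff (x, y) (fun w : V * V => g j w.1) (fun w => H j x w.1).
  exact: (is_diff_comp (is_diff_fst (x, y)) (gd j)).
have f2 j : is_diff (x, y) (fun w : V * V => w.2 0 j : C R) (fun w => w.2 0 j).
  exact: (is_diff_comp (is_diff_snd (x, y)) (is_diff_coord y j)).
have f3 j := is_diffMfun (f1 j) (f2 j).
exact: (is_diff_bigsum (index_enum 'I_n.+1) (P := xpredT) (fun j _ => f3 j)).
Qed.

Lemma is_derive_comp_real (gamma : R -> VR) (Y : VR -> VR) (v : VR) :
  is_derive (0 : R) (1 : R) gamma v -> differentiable Y (gamma 0) ->
  is_derive (0 : R) (1 : R) (fun t => Y (gamma t)) ('d Y (gamma 0) v).
Proof.
move=> gv Yd.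
have gd : differentiable gamma (0 : R) := (derivable1_diffP _ _).1 (ex_derive (is_derive := gv)).
have cd := differentiable_comp gd Yd.
apply: DeriveDef; first exact: diff_derivable.
have -> : (fun t => Y (gamma t)) = Y \o gamma by [].
rewrite (deriveE _ cd) (diff_comp gd Yd) /= -(deriveE _ gd).
by rewrite (derive_val (is_derive := gv)).
Qed.

(** Here z is the derivative D_X Y at p.  Differentiate the two conditions defining
    T^c M, satisfied by Y along a curve of M with velocity X(p).  The first one
    produces a Hessian term.  For the second one, if dPhi/dxi does not vanish at
    kap p, then along the curve it forces the z_1 component of Y to be 0. *)
Lemma derive_tangent_field p (X Y : VR -> VR) : conj_graph p ->
  differentiable Y (realify p) ->
  (\forall q \near realify p, (@realify R n.+1 @` conj_graph) q ->
     complex_tangent (@realify R n.+1 @` conj_graph) q (X q) /\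
     complex_tangent (@realify R n.+1 @` conj_graph) q (Y q)) ->
  let x := unreal (X (realify p)) in let y := unreal (Y (realify p)) in
  let z := unreal ('d Y (realify p) (X (realify p))) in
  z 0 ord_max = \sum_j (g j (kap p) * kap z 0 j + H j (kap p) (kap x) * kap y 0 j) /\
  g ord_max (kap p) * kap z 0 ord_max = 0.
Proof.
move=> Mp Yd XY x y z.
have MRp : (@realify R n.+1 @` conj_graph) (realify p) by exists p.
have [[[gamma [g0 gM gv]] _] _] := nbhs_singleton XY MRp.
have Yd0 : differentiable Y (gamma 0) by rewrite g0.
have Yv : is_derive (0 : R) (1 : R) (fun t => Y (gamma t))
    ('d Y (realify p) (X (realify p))).
  by have := is_derive_comp_real gv Yd0; rewrite g0.
have gd : differentiable gamma (0 : R) := (derivable1_diffP _ _).1 (ex_derive (is_derive := gv)).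
have gc : {for (0 : R), continuous gamma} := differentiable_continuous gd.
pose u t := unreal (gamma t); pose w t := unreal (Y (gamma t)).
have u0 : u 0 = p by rewrite /u g0 realifyK.
have w0 : w 0 = y by rewrite /w g0.
have ux : cder u x := is_derive_cder gv.
have wz : cder w z := is_derive_cder Yv.
have Tw : \forall t \near (0 : R), graph_tangent (u t) (w t) /\
    g ord_max (kap (u t)) * kap (w t) 0 ord_max = 0.
  have XY0 : \forall q \near gamma 0, (@realify R n.+1 @` conj_graph) q ->
     complex_tangent (@realify R n.+1 @` conj_graph) q (X q) /\
     complex_tangent (@realify R n.+1 @` conj_graph) q (Y q) by rewrite g0.
  apply: filterS2 gM (gc _ XY0) => t Mt /(_ Mt) [_].
  have [q Mq qE] := Mt.
  have uq : u t = q by rewrite /u -qE realifyK.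
  by rewrite -qE -[Y _]unrealK => /(complex_tangent_graphP _ Mq); rewrite uq /w -qE.
have [Up pE] := Mp.
have Dp := UD Up.
have ku := cder_kap ux; have kw := cder_kap wz.
have Fd : is_diff (kap (u 0), kap (w 0)) (fun w : V * V => \sum_j g j w.1 * w.2 0 j)
    (fun w => \sum_j (g j (kap p) * w.2 0 j + H j (kap p) w.1 * kap y 0 j)).
  by rewrite u0 w0; exact: is_diff_gradient.
split.
  apply: (cder_uniq (cder_coord ord_max wz) (cder_comp (cder_pair ku kw) Fd)).
  by apply: filterS Tw => t [].
(* The product of g_xi and the z_1 component vanishes along the curve; where
   g_xi is nonzero, the component itself vanishes. *)
have [gk|gk] := eqVneq (g ord_max (kap p)) 0; first by rewrite gk mul0r.
suff -> : kap z 0 ord_max = 0 by rewrite mulr0.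
apply: (cder_uniq (cder_coord ord_max kw) (@cder_cst R _ (0 : C R))).
have [_ gdiff _] := J Dp.
have gd0 : is_diff (kap (u 0)) (g ord_max) (H ord_max (kap p)) by rewrite u0.
have gu := cder_comp ku gd0.
have gnz : \forall c \near g ord_max (kap (u 0)), c != 0.
  apply/near_nr; exists (nr (g ord_max (kap p))).
    by rewrite lt_def nr_ge0 andbT; apply: contraNneq gk => /nr_eq0 ->.
  move=> c; rewrite u0; apply: contraTneq => ->.
  by rewrite sub0r nrN ltxx.
apply: filterS2 Tw (cder_nbhs gu gnz) => t [_ /eqP].
by rewrite mulf_eq0 => /orP[/eqP ->|/eqP //]; rewrite eqxx.
Qed.

(** In the difference D_X Y - D_Y X the two Hessian terms cancel by symmetry. *)
Theorem Levi_flat_conj_graph : Levi_flat (@realify R n.+1 @` conj_graph).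
Proof.
move=> _ [[p Mp <-] _] X Y XC YC XY.
have Xd : differentiable X (realify p) := (nbhs_singleton XC).1.
have Yd : differentiable Y (realify p) := (nbhs_singleton YC).1.
have YX : \forall q \near realify p, (@realify R n.+1 @` conj_graph) q ->
     complex_tangent (@realify R n.+1 @` conj_graph) q (Y q) /\
     complex_tangent (@realify R n.+1 @` conj_graph) q (X q).
  by apply: filterS XY => q HXY Mq; have [] := HXY Mq.
have [e1 k1] := derive_tangent_field Mp Yd XY.
have [e2 k2] := derive_tangent_field Mp Xd YX.
rewrite -[lie_bracket _ _ _]unrealK; apply/(complex_tangent_graphP _ Mp).
rewrite /lie_bracket unrealB /graph_tangent kapB.
have [_ _ sym] := J (UD Mp.1).
set z1 := unreal ('d Y _ _) in e1 k1 *; set z2 := unreal ('d X _ _) in e2 k2 *.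
have cB (a b : V) i : (a - b) 0 i = a 0 i - b 0 i by rewrite !mxE.
split; last by rewrite cB mulrBr k1 k2 subrr.
rewrite cB e1 e2 !big_split /= sym opprD addrACA subrr addr0 -sumrB.
by apply: eq_bigr => j _; rewrite cB mulrBr.
Qed.

End LeviFlat.

Section Main.
Variables (R : realType) (n : nat) (n_ge2 : (2 <= n)%N)
  (c : {ffun 'I_n.+1 -> nat} -> C R) (rho : R) (r : 'rV[C R]_n.+1 -> C R)
  (r_sum : is_pseries_sum c rho r)
  (U : set 'rV[C R]_n.+1) (U_nbhs : open_nbhs (0 : 'rV[C R]_n.+1) U)
  (U_polydisc : forall p, U p -> forall i, nr (z_conj1 p 0 i) < rho)
  (M : set 'rV[C R]_n.+1)
  (M_eq : M = [set p | U p /\ wcoord p = quadratic_part p + r (z_conj1 p)]).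

(** The defining function xi z_2 + xi^2 + r is a jet of order 2 as a sum of products
    of coordinates and of a power series. *)
Lemma Levi_flat_pseries_graph : Levi_flat (@realify R n.+1 @` M).
Proof.
have [rho0 _ _] := is_pseries_sumE r_sum.
have [g [H J]] := pseries_jet2 r_sum.
have Jc i : jet2 [set x | nr x < rho] (fun x : 'rV[C R]_n.+1 => x 0 i) _ _ := jet2_coord i.
have Jq := jet2D (jet2M (Jc ord_max) (Jc (inord 1))) (jet2M (Jc ord_max) (Jc ord_max)).
have JP := jet2D Jq J.
have Ud p : U p -> nr (z_conj1 p) < rho by move=> /U_polydisc; apply: nr_rV_lt.
have -> : M = conj_graph (fun x => x 0 ord_max * x 0 (inord 1) + x 0 ord_max * x 0 ord_max +
    gsum c (fun a => monom a x)) U.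
  rewrite M_eq; apply/seteqP; split=> p [Up pE]; split=> //.
    rewrite -[LHS]/(wcoord p) pE quadratic_partE !z_conj1E eqxx (i1_max n_ge2) expr2.
    by congr (_ + _); apply/esym/gsum_eq/(pseries_sums r_sum)/U_polydisc.
  rewrite /wcoord pE quadratic_partE !z_conj1E eqxx (i1_max n_ge2) expr2.
  by congr (_ + _); apply/gsum_eq/(pseries_sums r_sum)/U_polydisc.
exact: (Levi_flat_conj_graph n_ge2 JP U_nbhs.1 Ud).
Qed.

End Main.

Transparent C rc re im cj cplx nr diff.

Theorem theorem1p3 (R : realType) (n : nat) (n_ge2 : (2 <= n)%N)
  (c : {ffun 'I_n.+1 -> nat} -> C R) (rho : R) (r : 'rV[C R]_n.+1 -> C R)
  (r_sum : is_pseries_sum c rho r) (r_O3 : no_terms_below c 3)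
  (U : set 'rV[C R]_n.+1) (U_nbhs : open_nbhs (0 : 'rV[C R]_n.+1) U)
  (U_polydisc : forall p, U p -> forall i, `|z_conj1 p 0 i| < (rho%:C)%C)
  (M : set 'rV[C R]_n.+1)
  (M_eq : M = [set p | U p /\ wcoord p = quadratic_part p + r (z_conj1 p)]) :
  Levi_flat (@realify R n.+1 @` M) /\
  locally_biholo_equiv_at0 M (@quadric R n).
Proof.
have U_small p : U p -> forall i, nr (z_conj1 p 0 i) < rho.
  by move=> Up i; rewrite -normr_lt_rc; exact: U_polydisc.
split; first exact: (Levi_flat_pseries_graph n_ge2 r_sum U_nbhs U_small M_eq).
exact: (quadric_equiv n_ge2 r_sum r_O3 U_nbhs M_eq).
Qed.
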